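(* Let $G$ be a locally compact second countable group. Let $(\Omega,\mathcal F,\mathbb P)$ be a standard probability space, $T:\Omega\to\Omega$ an invertible, measure-preserving, ergodic transformation and $f:\Omega\to G$ a measurable map such that the associated cocycle $\varphi:\mathbb Z\times\Omega\to G$ satisfies the asymptotic past and future independence condition. Let $B_-$ and $B_+$ be the past and future Mackey ranges associated to $\varphi$. Then the diagonal $G$-action on $B_-\times B_+$ is metrically ergodic and coarsely metrically ergodic.
   Context: Cocycle. For $n\ge1$: $\varphi(0,\omega)=e$, $\varphi(n,\omega)=f(T^{n-1}\omega)\cdots f(\omega)$, $\varphi(-n,\omega)=f(T^{-n}\omega)^{-1}\cdots f(T^{-1}\omega)^{-1}$. Mackey ranges. Let $\mu_G$ be a probability measure on $G$ in the class of the Haar measure. Let $\tilde\Omega=G^{\mathbb Z}$ carry the image $\tilde{\mathbb P}$ of $\mathbb P\otimes\mu_G$ under $(\omega,g)\mapsto(\varphi(n,\omega)g^{-1})_{n\in\mathbb Z}$. $G$ acts by $g\cdot(g_n)_n=(g_ng^{-1})_n$, and $S(g_n)_n=(g_{n+1})_n$ is the shift. Let $\tilde\Omega_+$ (coordinates $n\ge0$) and $\tilde\Omega_-$ (coordinates $n\le-1$) carry the images $\tilde{\mathbb P}_\pm$ of $\tilde{\mathbb P}$ under the coordinate projections, with the analogous $G$-actions and the maps $S_+(g_n)_{n\ge0}=(g_{n+1})_{n\ge0}$, $S_-(g_n)_{n\le-1}=(g_{n-1})_{n\le-1}$. The future (resp. past) Mackey range $(B_+,\nu_+)$ (resp. $(B_-,\nu_-)$)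 is the space of ergodic components of $S_+$ (resp. $S_-$): the essentially unique standard probability space with non-singular $G$-action and a $G$-equivariant measurable map $\mathrm{bnd}_\pm:\tilde\Omega_\pm\to B_\pm$, $\nu_\pm=(\mathrm{bnd}_\pm)_*\tilde{\mathbb P}_\pm$, such that pull-back identifies $L^\infty(B_\pm,\nu_\pm)$ with the algebra of $S_\pm$-invariant functions in $L^\infty(\tilde\Omega_\pm,\tilde{\mathbb P}_\pm)$. Likewise $(B,\nu)$ is the space of ergodic components of $(\tilde\Omega,\tilde{\mathbb P},S)$. The projections $\tilde\Omega\to\tilde\Omega_\pm$ induce $G$-equivariant measurable maps $\pi_\pm:B\to B_\pm$. The product $B_-\times B_+$ carries $\nu_-\otimes\nu_+$. Asymptotic past and future independence condition (apafi): $\pi_-\times\pi_+:(B,\nu)\to(B_-\times B_+,\nu_-\otimes\nu_+)$ is measure-class preserving, i.e. $(\pi_-\times\pi_+)_*\nu$ and $\nu_-\otimes\nu_+$ have the same null sets. Metric ergodicity (also called isometric ergodicity). A non-singular $G$-action on a standard probability space $(Y,\eta)$ is metrically ergodic if for every separable metric space $(Z,d)$ on which $G$ acts by isometries, every $G$-equivariant measurable map $Y\to Z$ is essentially constant. Coarse metric ergodicity. A coarse metric on a set $Y$ is a function $d:Y\times Y\to\mathbb R_+$ for which there is $C>0$ with $d(x,x)\le C$, $d(x,y)\le d(y,x)+C$ and $d(x,z)\le d(x,y)+d(y,z)+C$ for all $x,y,z$. An essentially well-defined coarse metric on $(Y,\eta)$ is a conull subset $Y'\subseteq Y$ together with a coarse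 metric on $Y'$. The $G$-action on $(Y,\eta)$ is coarsely metrically ergodic if every essentially well-defined $G$-invariant Borel coarse metric $d$ is essentially bounded: there is $R>0$ with $d(x,y)\le R$ for $\eta\otimes\eta$-almost every $(x,y)$. *)

(* Defs.v *)
From HB Require Import structures.
From mathcomp Require Import all_boot all_order all_algebra.
From mathcomp Require Import all_classical all_reals all_analysis.

Set Implicit Arguments.
Unset Strict Implicit.
Unset Printing Implicit Defensive.

Import Order.TTheory GRing.Theory Num.Theory.

Local Open Scope classical_set_scope.
Local Open Scope ring_scope.

HB.mixin Record isBorelTopologicalGroup d G
    & Group G & PointedTopological G & Measurable d G := {
  mulg_continuous : continuous (fun xy : G * G => (xy.1 * xy.2)%g);
  invg_continuous : continuous (fun x : G => x^-1%g);
  measurable_borelE : (measurable : set (set G)) = <<s @open G >>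
}.

#[short(type="borelGroupType")]
HB.structure Definition BorelGroup d :=
  {G of Group G & PointedTopological G & Measurable d G
      & isBorelTopologicalGroup d G}.

Definition separable (X : topologicalType) :=
  exists2 D : set X, countable D & dense D.

(* Isomorphic, as a measurable space, to a Polish space with its Borel sets. *)
Definition standard_borel (R : realType) d (T : measurableType d) :=
  exists (X : completePseudoMetricType R) (h : T -> X),
    [/\ hausdorff_space X, separable X, bijective h &
        forall A : set T, measurable A <-> <<s @open X >> (h @` A)].

Section measure_class.
Context d (T : measurableType d) (R : realType).

Definition same_class (m1 m2 : set T -> \bar R) := m1 `<< m2 /\ m2 `<< m1.

Definition ess_bounded (m : set T -> \bar R) (u : T -> R) :=
  exists M : R, {ae m, forall x, `|u x| <= M}.

Definition measure_preserving (m : set T -> \bar R) (t : T -> T) :=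
  forall A, measurable A -> pushforward m t A = m A.

Definition ergodic (P : probability T R) (t : T -> T) :=
  forall A, measurable A -> t @^-1` A = A -> P A = 0%E \/ P A = 1%E.

End measure_class.

Section groups.
Context d (G : borelGroupType d) (R : realType).

(* On a locally compact second countable group, a Borel measure that is finite
   on compact sets is automatically regular. *)
Definition is_haar (m : {measure set G -> \bar R}) :=
  [/\ m setT != 0%E,
      forall K : set G, compact K -> (m K < +oo)%E &
      forall g : G, measure_preserving m (fun x => (g * x)%g)].

Definition haar_class (mu : probability G R) :=
  exists2 m : {measure set G -> \bar R}, is_haar m & same_class mu m.

Definition is_action (X : Type) (a : G -> X -> X) :=
  (forall x, a 1%g x = x) /\ (forall g h x, a (g * h)%g x = a g (a h x)).

Definition diag_action (X Y : Type) (aX : G -> X -> X) (aY : G -> Y -> Y)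
    (g : G) (p : X * Y) : X * Y := (aX g p.1, aY g p.2).

Definition nonsingular_action dY (Y : measurableType dY)
    (eta : probability Y R) (a : G -> Y -> Y) :=
  [/\ is_action a,
      measurable_fun [set: G * Y] (fun p => a p.1 p.2) &
      forall g, same_class (pushforward eta (a g)) eta].

Definition ae_equivariant dX (X : measurableType dX) (m : set X -> \bar R)
    (Y : Type) (aX : G -> X -> X) (aY : G -> Y -> Y) (F : X -> Y) :=
  forall g, {ae m, forall x, F (aX g x) = aY g (F x)}.

Section ergodicity.
Context dY (Y : measurableType dY) (eta : probability Y R) (a : G -> Y -> Y).

Definition metrically_ergodic :=
  forall (Z : metricType R) (aZ : G -> Z -> Z) (F : Y -> Z),
    separable Z ->
    is_action aZ ->
    (forall g z1 z2, mdist (aZ g z1) (aZ g z2) = mdist z1 z2) ->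
    (forall U : set Z, open U -> measurable (F @^-1` U)) ->
    ae_equivariant eta a aZ F ->
    exists z, {ae eta, forall y, F y = z}.

Definition coarse_metric_on (Y' : set Y) (D : Y -> Y -> R) :=
  (forall x y, Y' x -> Y' y -> 0 <= D x y) /\
  exists2 C : R, 0 < C &
    [/\ forall x, Y' x -> D x x <= C,
        forall x y, Y' x -> Y' y -> D x y <= D y x + C &
        forall x y z, Y' x -> Y' y -> Y' z -> D x z <= D x y + D y z + C].

(* Only the values of D on Y' x Y' matter. The conull set Y' need not be
   G-invariant: invariance is required whenever both sides are defined. *)
Definition coarsely_metrically_ergodic :=
  forall (Y' : set Y) (D : Y -> Y -> R),
    measurable Y' -> eta (~` Y') = 0%E ->
    coarse_metric_on Y' D ->
    measurable_fun (Y' `*` Y') (fun p => D p.1 p.2) ->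
    (forall g x y, Y' x -> Y' y -> Y' (a g x) -> Y' (a g y) ->
      D (a g x) (a g y) = D x y) ->
    exists2 r : R, 0 < r & {ae (eta \x eta)%E, forall p, D p.1 p.2 <= r}.

End ergodicity.

Section ergodic_components.
Context dX (X : measurableType dX) (m : set X -> \bar R) (S : X -> X)
  (aX : G -> X -> X).
Context dB (B : measurableType dB) (nu : probability B R) (aB : G -> B -> B)
  (bnd : X -> B).

(* Every S-invariant class in L^oo(X, m) is the pull-back of a class in
   L^oo(B, nu), and conversely; the pull-back is injective since nu is the
   image of m. *)
Definition ergodic_components :=
  [/\ standard_borel R B /\ nonsingular_action nu aB,
      measurable_fun setT bnd /\ ae_equivariant m aX aB bnd,
      forall A, measurable A -> nu A = pushforward m bnd A,
      forall h : B -> R, measurable_fun setT h -> ess_bounded nu h ->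
        {ae m, forall x, h (bnd (S x)) = h (bnd x)} &
      forall u : X -> R, measurable_fun setT u -> ess_bounded m u ->
        {ae m, forall x, u (S x) = u x} ->
        exists h : B -> R, [/\ measurable_fun setT h, ess_bounded nu h &
          {ae m, forall x, u x = h (bnd x)}]].

End ergodic_components.

End groups.

Section paths.
Context d (G : borelGroupType d).

Definition cylinders (I : Type) : set (set (I -> G)) :=
  \bigcup_(i : I) preimage_set_system setT (fun x : I -> G => x i) measurable.

Definition paths (I : Type) := g_sigma_algebraType (@cylinders I).

Definition path_action (I : Type) (g : G) (x : paths I) : paths I :=
  fun i => (x i * g^-1)%g.

Definition shift (x : paths int) : paths int := fun n => x (n + 1).

Definition future (x : paths int) : paths nat := fun k => x (Posz k).

(* The index k stands for the coordinate n = - (k + 1) <= -1. *)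
Definition past (x : paths int) : paths nat := fun k => x (Negz k).

(* This is S_+ on the future and, in view of the indexing, also S_- on the past:
   the coordinate n - 1 = - (k + 2) has index k + 1. *)
Definition shift1 (x : paths nat) : paths nat := fun k => x k.+1.

Section cocycle.
Context (R : realType) dO (Omega : measurableType dO).
Variables (P : probability Omega R) (muG : probability G R).
Variables (T Tinv : Omega -> Omega) (f : Omega -> G).

Fixpoint cocycle_pos (n : nat) (w : Omega) : G :=
  if n is m.+1 then (f (iter m T w) * cocycle_pos m w)%g else 1%g.

Fixpoint cocycle_neg (n : nat) (w : Omega) : G :=
  if n is m.+1 then ((f (iter m.+1 Tinv w))^-1 * cocycle_neg m w)%g else 1%g.

Definition cocycle (n : int) (w : Omega) : G :=
  match n with
  | Posz m => cocycle_pos m w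
  | Negz m => cocycle_neg m.+1 w
  end.

Definition path_of (p : Omega * G) : paths int :=
  fun n => (cocycle n p.1 * p.2^-1)%g.

Definition path_law : set (paths int) -> \bar R :=
  pushforward (P \x muG)%E path_of.

Definition future_law : set (paths nat) -> \bar R := pushforward path_law future.

Definition past_law : set (paths nat) -> \bar R := pushforward path_law past.

Definition future_mackey_range dB (B : measurableType dB)
    (nu : probability B R) (a : G -> B -> B) (bnd : paths nat -> B) :=
  ergodic_components future_law shift1 (@path_action nat) nu a bnd.

Definition past_mackey_range dB (B : measurableType dB)
    (nu : probability B R) (a : G -> B -> B) (bnd : paths nat -> B) :=
  ergodic_components past_law shift1 (@path_action nat) nu a bnd.

Definition mackey_range dB (B : measurableType dB)
    (nu : probability B R) (a : G -> B -> B) (bnd : paths int -> B) :=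
  ergodic_components path_law shift (@path_action int) nu a bnd.

Definition induced_map (pr : paths int -> paths nat)
    dB (B : measurableType dB) (nu : probability B R) (a : G -> B -> B)
    (bnd : paths int -> B)
    dB1 (B1 : measurableType dB1) (a1 : G -> B1 -> B1) (bnd1 : paths nat -> B1)
    (pi : B -> B1) :=
  [/\ measurable_fun setT pi,
      ae_equivariant nu a a1 pi &
      {ae path_law, forall x, pi (bnd x) = bnd1 (pr x)}].

End cocycle.

Definition apafi (R : realType)
    dB (B : measurableType dB) (nu : probability B R)
    dm (Bm : measurableType dm) (num : probability Bm R)
    dp (Bp : measurableType dp) (nup : probability Bp R)
    (pim : B -> Bm) (pip : B -> Bp) :=
  same_class (pushforward nu (fun b => (pim b, pip b))) (num \x nup)%E.

End paths.

(* Main.v *)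
Require Import Defs.
From mathcomp Require Import all_boot all_order all_algebra.
From mathcomp Require Import all_classical all_reals all_analysis.
From mathcomp Require Import measurable_realfun zify lra.
Set Implicit Arguments.
Unset Strict Implicit.
Unset Printing Implicit Defensive.
Import Order.TTheory GRing.Theory Num.Theory.
Import numFieldNormedType.Exports.
Local Open Scope classical_set_scope.
Local Open Scope ring_scope.

(** Write [x = (w, g)] for a point of [Omega * G] and [y x] for the pair of its
    images in [Bm] and [Bp]; by (apafi) the law of [y] has the null sets of
    [num \x nup].  Let [D] be an invariant coarse metric on [Bm * Bp] for which
    almost every point has balls of radius [C] of positive measure, and let
    [net] be a sequence whose balls of radius [C] cover almost everything.  The
    index [i] of a ball containing the value of [y] at a remote negative time,
    with an independently chosen starting point in [G], is determined up to a
    small error by finitely many path coordinates around that time, hence by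
    the past.  As [y] is invariant under the skew product and [D] under [G],
    transporting [net i] back to time [0] gives points which depend on the past
    only and which, by Borel-Cantelli, are eventually within [C] of [y].  So the
    sets of those [i] for which [net i] is close to [y] are essentially
    shift-invariant functions of the past, that is, functions of the first
    coordinate of [y].  Likewise they are functions of the second coordinate.
    Being functions of each of two independent variables, they are essentially
    constant, and [D] is bounded by a multiple of [C].

    For the metric [D (b, b') = dist (F b, F b')] all [C > 0] are allowed, and
    [F] is constant.  For a coarse metric, the set of points whose balls of
    radius [L] have positive measure is invariant, hence null or conull by the
    same argument applied to its indicator function, so some [L] will do. *)

(** * Null sets *)

Lemma measurable_preimage d1 d2 (X1 : measurableType d1)
    (X2 : measurableType d2) (t : X1 -> X2) A :
  measurable_fun setT t -> measurable A -> measurable (t @^-1` A).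
Proof. by move=> mt mA; rewrite -[_ @^-1` _]setTI; exact: mt. Qed.

Section null_sets.
Context d1 d2 (X1 : measurableType d1) (X2 : measurableType d2) (R : realType).

(** Only absolute continuity of the image of [m1] with respect to [m2] is recorded: this is what
    pulls back almost everywhere statements, and it is stable under composition. *)
Definition nonsingular (m1 : set X1 -> \bar R) (m2 : set X2 -> \bar R)
    (t : X1 -> X2) :=
  measurable_fun setT t /\
  forall A, measurable A -> m2 A = 0%E -> m1 (t @^-1` A) = 0%E.

Lemma nonsingular_ae (m1 : set X1 -> \bar R) (m2 : set X2 -> \bar R)
    (t : X1 -> X2) (Q : X2 -> Prop) :
  nonsingular m1 m2 t -> {ae m2, forall x, Q x} -> {ae m1, forall x, Q (t x)}.
Proof.
move=> [mt t0] [N [mN N0 QN]]; exists (t @^-1` N); split.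
- by rewrite -[_ @^-1` _]setTI; exact: mt.
- exact: t0.
- by move=> x /= Qx; exact: QN.
Qed.

End null_sets.

Lemma nonsingular_comp d1 d2 d3 (R : realType) (X1 : measurableType d1)
    (X2 : measurableType d2) (X3 : measurableType d3) (m1 : set X1 -> \bar R)
    (m2 : set X2 -> \bar R) (m3 : set X3 -> \bar R) (s : X1 -> X2) (t : X2 ->
      X3) :
  nonsingular m1 m2 s -> nonsingular m2 m3 t -> nonsingular m1 m3 (t \o s).
Proof.
move=> [ms s0] [mt t0]; split; first exact: measurableT_comp.
move=> A mA A0; rewrite comp_preimage; apply: s0 (t0 _ mA A0).
by rewrite -[_ @^-1` _]setTI; exact: mt.
Qed.

Section null_sets_one.
Context d (X : measurableType d) (R : realType) (m : probability X R).

Lemma ae_null (Q : X -> Prop) : measurable [set x | Q x] ->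
  {ae m, forall x, Q x} <-> m (~` [set x | Q x]) = 0%E.
Proof. by move=> mQ; apply: negligibleP; exact: measurableC. Qed.

Lemma ae_positive (A : set X) (Q : X -> Prop) : (0 < m A)%E ->
  measurable A -> {ae m, forall x, Q x} -> exists2 x, A x & Q x.
Proof.
move=> A0 mA [N [mN N0 QN]]; apply: contrapT => /forall2NP nQ.
suff : m A = 0%E by move=> A0'; rewrite A0' ltxx in A0.
apply: (subset_measure0 mA mN _ N0) => x Ax; apply: QN => /= Qx.
by have [] := nQ x.
Qed.

Lemma ae_witness (Q : X -> Prop) :
  {ae m, forall x, Q x} -> exists x, Q x.
Proof.
move=> /(@ae_positive setT); case=> [||x _ Qx]; last by exists x.
  by rewrite probability_setT.
exact: measurableT.
Qed.

End null_sets_one.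

Section null_sets_prod.
Context d1 d2 (X1 : measurableType d1) (X2 : measurableType d2) (R : realType).
Implicit Types (m : probability X1 R) (n : probability X2 R).

Lemma prod_null m n A : measurable A ->
  (m \x n)%E A = 0%E <-> {ae m, forall x, n (xsection A x) = 0%E}.
Proof.
move=> mA; have mf := measurable_fun_xsection n mA.
rewrite /product_measure1.
have -> : (\int[m]_x (n \o xsection A) x = \int[m]_x `|(n \o xsection A) x|)%E.
  by apply: eq_integral => x _; rewrite gee0_abs.
rewrite ae_eq_integral_abs//; split.
  by apply: filterS => x /(_ I).
by apply: filterS => x + _.
Qed.

Lemma prod_null_swap m n A : measurable A ->
  (m \x n)%E A = 0%E <-> {ae n, forall y, m (ysection A y) = 0%E}.
Proof.
move=> mA; have mf := measurable_fun_ysection m mA.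
have -> : (m \x n)%E A = (m \x^ n)%E A.
  by apply: product_measure_unique => //= ? ? ? ?; rewrite product_measure2E.
rewrite /product_measure2.
have -> : (\int[n]_x (m \o ysection A) x = \int[n]_x `|(m \o ysection A) x|)%E.
  by apply: eq_integral => x _; rewrite gee0_abs.
rewrite ae_eq_integral_abs//; split.
  by apply: filterS => x /(_ I).
by apply: filterS => x + _.
Qed.

Lemma ae_prod m n (Q : X1 -> X2 -> Prop) :
  measurable [set p : X1 * X2 | Q p.1 p.2] ->
  {ae (m \x n)%E, forall p, Q p.1 p.2} <->
  {ae m, forall x, {ae n, forall y, Q x y}}.
Proof.
move=> mQ; rewrite (ae_null (m \x n)%E mQ) prod_null; last exact: measurableC.
have E x : xsection (~` [set p : X1 * X2 | Q p.1 p.2]) x = ~` [set y | Q x y].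
  by apply/seteqP; split => y; rewrite /xsection/= inE.
have mE x : measurable [set y | Q x y].
  by rewrite -[X in measurable X]setCK -E;
    apply/measurableC/measurable_xsection/measurableC.
by split; apply: filterS => x; rewrite E => /ae_null; apply.
Qed.

(** Fubini is applied to a measurable null set containing the exceptional set, so that [Q] itself
    may be arbitrary. *)
Lemma ae_prodW m n (Q : X1 -> X2 -> Prop) :
  {ae (m \x n)%E, forall p, Q p.1 p.2} ->
  {ae m, forall x, {ae n, forall y, Q x y}}.
Proof.
move=> [N [mN N0 QN]]; move/prod_null: N0 => /(_ mN).
apply: filterS => x Nx; exists (xsection N x); split => //.
  exact: measurable_xsection.
by move=> y /= Qxy; rewrite /xsection/= inE; exact: QN.
Qed.

Lemma ae_prodW_swap m n (Q : X1 -> X2 -> Prop) :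
  {ae (m \x n)%E, forall p, Q p.1 p.2} ->
  {ae n, forall y, {ae m, forall x, Q x y}}.
Proof.
move=> [N [mN N0 QN]]; move/prod_null_swap: N0 => /(_ mN).
apply: filterS => y Ny; exists (ysection N y); split => //.
  exact: measurable_ysection.
by move=> x /= Qxy; rewrite /ysection/= inE; exact: QN.
Qed.

Lemma ae_fst m n (Q : X1 -> Prop) :
  {ae m, forall x, Q x} -> {ae (m \x n)%E, forall p, Q p.1}.
Proof.
apply: nonsingular_ae; split=> [|A mA A0]; first exact: measurable_fst.
have -> : fst @^-1` A = A `*` [set: X2] by apply/seteqP; split => -[x y] //= [].
by rewrite product_measure1E// [X in (X * _)%E]A0 mul0e.
Qed.

Lemma ae_snd m n (Q : X2 -> Prop) :
  {ae n, forall x, Q x} -> {ae (m \x n)%E, forall p, Q p.2}.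
Proof.
apply: nonsingular_ae; split=> [|A mA A0]; first exact: measurable_snd.
have -> : snd @^-1` A = [set: X1] `*` A by apply/seteqP; split => -[x y] //= [].
by rewrite product_measure1E// [X in (_ * X)%E]A0 mule0.
Qed.

(** Makes nested almost everywhere quantifiers eligible for Fubini again: the set in question is
    where the measure of a section of the complement vanishes. *)
Lemma measurable_ae_section n (Q : X1 -> X2 -> Prop) :
  measurable [set p : X1 * X2 | Q p.1 p.2] ->
  measurable [set x | {ae n, forall y, Q x y}].
Proof.
move=> mQ; have E x : xsection (~` [set p : X1 * X2 | Q p.1 p.2]) x =
  ~` [set y | Q x y].
  by apply/seteqP; split => y; rewrite /xsection/= inE.
have mE x : measurable [set y | Q x y].
  by rewrite -[X in measurable X]setCK -E;
    apply/measurableC/measurable_xsection/measurableC.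
have mf := measurable_fun_xsection n (measurableC mQ).
have -> : [set x | {ae n, forall y, Q x y}] =
   (n \o xsection (~` [set p : X1 * X2 | Q p.1 p.2])) @^-1` [set 0%E].
  by apply/seteqP; split => x /=; rewrite E => /ae_null; apply.
by rewrite -[_ @^-1` _]setTI; apply: mf => //; exact: emeasurable_set1.
Qed.

End null_sets_prod.

Section null_sets_swap.
Context d1 d2 (X1 : measurableType d1) (X2 : measurableType d2) (R : realType).
Implicit Types (m : probability X1 R) (n : probability X2 R).

Lemma ae_swap m n (Q : X1 -> X2 -> Prop) :
  measurable [set p : X1 * X2 | Q p.1 p.2] ->
  {ae m, forall x, {ae n, forall y, Q x y}} ->
  {ae n, forall y, {ae m, forall x, Q x y}}.
Proof. by move=> mQ /(ae_prod _ _ mQ)/ae_prodW_swap. Qed.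

Lemma nonsingular_iter (m1 : set X1 -> \bar R) (t : X1 -> X1) k :
  nonsingular m1 m1 t -> nonsingular m1 m1 (iter k t).
Proof.
move=> t0; elim: k => [|k IH]; first by split=> //; exact: measurable_id.
exact: (nonsingular_comp IH t0).
Qed.

(** The fibre over [x] of the preimage of a null set is the preimage under [t x] of the fibre over
    [s x], which is null for almost every [x]. *)
Lemma nonsingular_prod m n (s : X1 -> X1) (t : X1 -> X2 -> X2) :
  nonsingular m m s -> measurable_fun setT (fun p : X1 * X2 => t p.1 p.2) ->
  (forall x, nonsingular n n (t x)) ->
  nonsingular (m \x n)%E (m \x n)%E (fun p => (s p.1, t p.1 p.2)).
Proof.
move=> s0 mt t0.
have mst : measurable_fun setT (fun p : X1 * X2 => (s p.1, t p.1 p.2)).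
  apply/measurable_fun_pairP; split=> //=.
  exact: (measurableT_comp s0.1 measurable_fst).
split=> // A mA /(prod_null _ _ mA) A0; apply/prod_null.
  by rewrite -[_ @^-1` _]setTI; exact: mst.
apply: filterS (nonsingular_ae s0 A0) => x Ax.
rewrite (_ : xsection _ _ = t x @^-1` xsection A (s x)); last first.
  by apply/seteqP; split => y; rewrite /xsection/= !inE.
by apply: (t0 x).2 => //; exact: measurable_xsection.
Qed.

End null_sets_swap.

Lemma countable_enum (T : Type) (A : set T) (x0 : T) : A x0 -> countable A ->
  exists u : nat -> T, (forall n, A (u n)) /\ forall x, A x -> exists n, u n =
    x.
Proof.
move=> Ax0 /countable_injP[f finj].
(* Numbers that code no element of [A] are sent to the default [x0]. *)
have /choice[u uP] n : exists x, A x /\ forall y, A y -> f y = n -> x = y.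
  have [[y [Ay fy]]|nA] := pselect (exists y, A y /\ f y = n).
    by exists y; split=> // z Az fz; apply: finj; rewrite ?inE// fy fz.
  by exists x0; split=> // y Ay fy; case: nA; exists y.
exists u; split=> [n|x Ax]; first by have [] := uP n.
by exists (f x); have [_] := uP (f x); apply.
Qed.

Section null_equiv.
Context d (X : measurableType d) (R : realType).

Lemma same_classP (m1 m2 : {measure set X -> \bar R}) A :
  same_class m1 m2 -> measurable A -> m1 A = 0%E <-> m2 A = 0%E.
Proof.
by move=> [m12 m21] mA; split=> A0;
  [apply: (m21 A) => //|apply: (m12 A) => //]; apply/measure0_null_setP.
Qed.

End null_equiv.

(** * Null sets of Haar measure *)

Section group_measurability.
Context d (G : borelGroupType d) (R : realType).
Hypothesis G2 : @second_countable G.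

Lemma measurable_open (U : set G) : open U -> measurable U.
Proof. by move=> oU; rewrite measurable_borelE; exact: sub_sigma_algebra. Qed.

(** The measurable sets of [G * G] are generated by rectangles, so the open preimage of an open set
    has to be a countable union of them; a countable basis of [G] provides the rectangles. *)
Lemma measurable_mulg : measurable_fun [set: G * G] (fun p => (p.1 * p.2)%g).
Proof.
apply: (@measurability _ _ _ _ _ _ (@open G)) => [|_ [U oU <-]]; first exact:
  measurable_borelE.
have [B cB [Bo Bb]] := G2; rewrite setTI.
pose I := [set VW : set G * set G | [/\ B VW.1, B VW.2 &
  VW.1 `*` VW.2 `<=` (fun p : G * G => (p.1 * p.2)%g) @^-1` U]].
have -> : (fun p : G * G => (p.1 * p.2)%g) @^-1` U = \bigcup_(VW in I)
  (VW.1 `*` VW.2).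
  apply/seteqP; split=> [[x y]/= Uxy|p [VW [_ _ VWU] /VWU//]].
  have : nbhs ((x, y) : G * G) ((fun p : G * G => (p.1 * p.2)%g) @^-1` U).
    by apply: mulg_continuous; exact: open_nbhs_nbhs.
  move=> [[/= V W] [/= /Bb[V' [BV' V'x] V'V] /Bb[W' [BW' W'y] W'W]] VWU].
  exists (V', W') => //; split=> //= -[a b] /= [V'a W'b].
  by apply: (VWU (a, b)); split; [exact: V'V|exact: W'W].
have mVW VW : I VW -> measurable (VW.1 `*` VW.2).
  by move=> [/Bo o1 /Bo o2 _]; apply: measurableX; exact: measurable_open.
have cI : countable I.
  by apply: sub_countable (countableX cB cB); apply: subset_card_le => VW [].
have [->|/set0P[VW0 IVW0]] := eqVneq I set0; first by rewrite bigcup_set0;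
  exact: measurable0.
have [u [Iu uI]] := countable_enum IVW0 cI.
rewrite (_ : \bigcup_(VW in I) _ = \bigcup_n ((u n).1 `*` (u n).2)).
  by apply: bigcupT_measurable => n; exact: mVW.
apply/seteqP; split=> [p [VW /uI[n <-] pn]|p [n _ pn]]; first by exists n.
by exists (u n).
Qed.

Lemma measurable_invg : measurable_fun [set: G] (fun x => x^-1%g).
Proof.
apply: (@measurability _ _ _ _ _ _ (@open G)) => [|_ [U oU <-]]; first exact:
  measurable_borelE.
rewrite setTI.
apply: measurable_open; apply: open_comp => // x _; exact: invg_continuous.
Qed.

Lemma measurable_fun_mulg d' (X : measurableType d') (u v : X -> G) :
  measurable_fun setT u -> measurable_fun setT v ->
  measurable_fun setT (fun x => (u x * v x)%g).
Proof.
move=> mu mv; apply: (measurableT_comp measurable_mulg (g := fun x => (u x,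
  v x))).
exact/measurable_fun_pairP.
Qed.

Lemma measurable_fun_invg d' (X : measurableType d') (u : X -> G) :
  measurable_fun setT u -> measurable_fun setT (fun x => (u x)^-1%g).
Proof. by move=> mu; have := measurableT_comp measurable_invg mu. Qed.

Variables (mu : probability G R) (mu_haar : haar_class mu).

Lemma haar_class_lmul (g : G) : nonsingular mu mu (fun x => (g * x)%g).
Proof.
have [m [_ _ mg] mum] := mu_haar.
have mf : measurable_fun [set: G] (fun x => (g * x)%g).
  by apply: measurable_fun_mulg; [exact: measurable_cst|exact: measurable_id].
split=> // A mA A0.
have mgA : measurable ((fun x : G => (g * x)%g) @^-1` A).
  exact: (measurable_preimage mf).
by apply/(same_classP mum mgA); have := mg g _ mA; rewrite /pushforward => ->;
  apply/(same_classP mum mA).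
Qed.

(* The translates of a null set on one side being null, by Fubini almost all
   translates of its inverse on the other side are null; one is enough. *)
Lemma haar_class_inv : nonsingular mu mu (fun x => x^-1%g).
Proof.
split=> [|A mA A0]; first exact: measurable_invg.
have mB : measurable [set p : G * G | ~ A (p.1^-1 * p.2)%g].
  have mf : measurable_fun [set: G * G] (fun p => (p.1^-1 * p.2)%g).
    apply: measurable_fun_mulg; last exact: measurable_snd.
    exact: measurable_fun_invg measurable_fst.
  exact: (measurable_preimage mf (measurableC mA)).
have [y Ay] : exists y, {ae mu, forall x, ~ A (x^-1 * y)%g}.
  apply: (ae_witness (m := mu)).
  apply: (ae_swap (m := mu) (n := mu) (Q := fun x y => ~ A (x^-1 * y)%g)) => //.
  apply: aeW => x; apply: (nonsingular_ae (Q := fun z => ~ A z)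
    (haar_class_lmul x^-1%g)).
  by exists A; split => // y /= /contrapT.
move/(nonsingular_ae (haar_class_lmul y)) in Ay.
have mAV : measurable ((fun x : G => x^-1%g) @^-1` A).
  exact: (measurable_preimage measurable_invg).
apply/(negligibleP _ mAV); apply: negligibleS Ay => x /= Ax; apply.
by rewrite invgM -mulgA mulVg mulg1.
Qed.

Lemma haar_class_rmul (g : G) : nonsingular mu mu (fun x => (x * g)%g).
Proof.
have -> : (fun x : G => (x * g)%g) =
    (fun x => x^-1%g) \o (fun x => (g^-1 * x)%g) \o (fun x => x^-1%g).
  by apply/funext => x /=; rewrite invgM !invgK.
apply: nonsingular_comp haar_class_inv _.
exact: nonsingular_comp (haar_class_lmul _) haar_class_inv.
Qed.

End group_measurability.

Section countable_net.
Context d (Y : measurableType d) (R : realType) (eta : probability Y R).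

(* Exhaustion: a sequence whose union has the largest possible measure covers
   almost everything, as otherwise Fubini provides a further section meeting
   the complement in positive measure. *)
Lemma countable_net (E : Y -> Y -> Prop) (N : set Y) :
  measurable [set p : Y * Y | E p.1 p.2] ->
  {ae eta, forall x, N x} ->
  {ae eta, forall y, ~ {ae eta, forall x, ~ E x y}} ->
  exists u : nat -> Y, (forall n, N (u n)) /\
    {ae eta, forall y, exists n, E (u n) y}.
Proof.
move=> mE NP Epos.
have [y0 Ny0] := ae_witness NP.
pose U (u : nat -> Y) := \bigcup_n [set y | E (u n) y].
have mE1 x : measurable [set y | E x y].
  have -> : [set y | E x y] = xsection [set p : Y * Y | E p.1 p.2] x.
    by apply/seteqP; split => y; rewrite /xsection/= inE.
  exact: measurable_xsection.
have mU u : measurable (U u) by exact: bigcupT_measurable.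
pose S := [set fine (eta (U u)) | u in [set u : nat -> Y | forall n, N (u n)]].
have S_ub : has_ubound S.
  exists 1 => _ [u _ <-]; rewrite -lee_fin fineK ?fin_num_measure//.
  exact: probability_le1.
have S0 : S !=set0 by exists (fine (eta (U (fun=> y0)))), (fun=> y0).
have hS : has_sup S by [].
have /choice[u uP] k : exists u : nat -> Y, (forall n, N (u n)) /\
    sup S - k.+1%:R^-1 < fine (eta (U u)).
  have k0 : (0 : R) < k.+1%:R^-1 by rewrite invr_gt0.
  by have [_ [u Nu <-] lt] := sup_adherent k0 hS; exists u.
(* [v] runs through all terms of all the nearly optimal sequences [u k], so its union attains the
   supremum; [y0] fills the indices that code no pair. *)
pose v n := if unpickle n is Some (i, j) then u i j else y0.
have Nv n : N (v n).
  by rewrite /v; case: unpickle => [[i j]|//]; have [] := uP i.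
have leU A B : measurable A -> measurable B -> A `<=` B -> fine (eta A) <=
  fine (eta B).
  move=> mA mB AB; rewrite fine_le ?fin_num_measure// le_measure// ?inE//.
have supv : sup S <= fine (eta (U v)).
  apply/ler_addgt0Pr => e e0; rewrite -lerBlDr.
  have [k ke] : exists k : nat, k.+1%:R^-1 < e.
    by have [k] := ltr_add_invr e0; rewrite add0r; exists k.
  have [_ /ltW uk] := uP k; apply: le_trans (lerB (lexx _) (ltW ke)) _.
  apply: le_trans uk _; apply: leU => // y [n _ ukn].
  by exists (pickle (k, n)) => //; rewrite /= /v pickleK.
exists v; split=> //; apply: contrapT => nv.
have mK := measurableC (mU v).
have K0 : (0 < eta (~` U v))%E.
  rewrite lt0e measure_ge0 andbT; apply/eqP => K0; apply: nv.
  exists (~` U v); split => // y /= Ey [n _ Eny]; apply: Ey; by exists n.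
have mQ : measurable [set p : Y * Y | ~ (E p.1 p.2 /\ (~` U v) p.2)].
  apply: (measurableC (A := [set p : Y * Y | E p.1 p.2 /\ (~` U v) p.2])).
  exact: measurableI mE (measurable_preimage measurable_snd mK).
(* Otherwise, after exchanging the quantifiers, some [y] in the uncovered set would be related to
   almost no [x], against [Epos]. *)
have [x Nx xK] : exists2 x, N x & ~ {ae eta, forall y, ~ (E x y /\ (~` U v) y)}.
  apply: contrapT => /forall2NP H.
  have : {ae eta, forall x, {ae eta, forall y, ~ (E x y /\ (~` U v) y)}}.
    by apply: filterS NP => x Nx; have [//|/contrapT] := H x.
  move=> /(ae_swap (Q := fun x y => ~ (E x y /\ (~` U v) y)) mQ) Ky.
  have [y Kny [nE aeK]] := ae_positive K0 mK (filterI Epos Ky).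
  by apply: nE; apply: filterS aeK => x nE Exy; apply: nE.
(* Putting [x] in front of [v] adds a set of positive measure to the union, which then exceeds the
   supremum. *)
pose w n := if n is m.+1 then v m else x.
have Nw n : N (w n) by case: n.
have mEK : measurable ([set y | E x y] `&` ~` U v) by exact: measurableI.
have EK0 : (0 < eta ([set y | E x y] `&` ~` U v))%E.
  rewrite lt0e measure_ge0 andbT; apply/eqP => K0'; apply: xK.
  by exists ([set y | E x y] `&` ~` U v); split => // y /= /contrapT.
have wv : U v `|` ([set y | E x y] `&` ~` U v) `<=` U w.
  move=> y [[n _ vn]|[Exy _]]; first by exists n.+1.
  by exists 0%N.
have : fine (eta (U v `|` ([set y | E x y] `&` ~` U v))) <= sup S.
  apply: le_trans (leU _ _ _ (mU w) wv) _; first exact: measurableU.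
  by apply: ub_le_sup => //; exists w.
rewrite measureU//; last by apply/seteqP; split=> // y [? []].
rewrite fineD ?fin_num_measure// => le1; have := le_trans le1 supv.
rewrite gerDl leNgt fine_gt0// EK0/=.
by rewrite ltey_eq fin_num_measure.
Qed.

End countable_net.

(** * Events determined by remote coordinates *)

Lemma borel_cantelli_ae d (T : measurableType d) (R : realType)
    (m : probability T R) (bad : nat -> set T) :
  (forall n, measurable (bad n)) ->
  (forall n, (m (bad n) <= (1 / (2 ^ n.+1)%:R)%:E)%E) ->
  {ae m, forall x, exists N, forall n, (N <= n)%N -> ~ bad n x}.
Proof.
move=> mbad bad_le; exists (lim_sup_set bad); split.
- by apply: bigcap_measurableType => n _; exact: bigcup_measurable.
- apply: lim_sup_set_cvg0 => //.
  apply: (@le_lt_trans _ _ (\sum_(n <oo) (1 / (2 ^ n.+1)%:R)%:E)%E).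
    by apply: lee_nneseries => // k _; exact: bad_le.
  by apply: le_lt_trans (epsilon_trick0 xpredT ler01) _; rewrite ltry.
- move=> x /= nx N _; apply: contrapT => H; apply: nx; exists N => n Nn bn.
  by apply: H; exists n.
Qed.

(** The sets of points lying in some [F i] but in none of the first [I] decrease to the empty set,
    so continuity from above applies. *)
Lemma tail_small d (R : realType) (T : measurableType d) (m : probability T R)
    (F : nat -> set T) (e : R) :
  (forall i, measurable (F i)) -> 0 < e -> exists I,
    (m [set x | (exists i, F i x) /\ forall i, (i < I)%N -> ~ F i x] < e%:E)%E.
Proof.
move=> mF e0.
pose T' I := [set x | (exists i, F i x) /\ forall i, (i < I)%N -> ~ F i x].
have mT' I : measurable (T' I).
  rewrite (_ : T' I = \bigcup_i F i `&` \bigcap_(i in [set i | (i < I)%N])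
    ~` F i).
    apply: measurableI; first exact: bigcupT_measurable.
    by apply: bigcap_measurableType => i _; exact: measurableC.
  by apply/seteqP; split=> x [[i Fi]] H; split=> //; exists i.
have T'0 : \bigcap_I T' I = set0.
  apply/seteqP; split=> // x T'x; have [[i Fix] _] := T'x 0%N I.
  by have [_ /(_ i (ltnSn i))] := T'x i.+1 I.
have := @nonincreasing_cvg_mu _ _ _ m T'; rewrite T'0 measure0.
move=> /(_ _ mT' measurable0) H.
have {H} : m (T' I) @[I --> \oo] --> 0%E.
  apply: H; first by rewrite ltey_eq fin_num_measure.
  move=> a b ab; apply/subsetPset => x [Fx nF]; split=> // i ia.
  by apply: nF; exact: leq_trans ab.
move=> /fine_cvgP[_ /cvgrPdist_lt/(_ _ e0)[N _ /(_ N (leqnn N))]].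
rewrite /= sub0r normrN ger0_norm ?fine_ge0// => le; exists N.
have fN : m (T' N) \is a fin_num by rewrite fin_num_measure.
by rewrite -/(T' N) -(fineK fN) lte_fin.
Qed.

Section asymptotic_approximation.
Context dX dV dW (X : measurableType dX) (V : measurableType dV)
  (W : measurableType dW) (R : realType).
Variables (Q : probability W R).
Variables (z : nat -> W -> X) (r : W -> V).
Hypotheses (z_meas : forall n, measurable_fun setT (z n))
  (r_meas : measurable_fun setT r)
  (z_law : forall n A, measurable A -> Q (z n @^-1` A) = Q (z 0%N @^-1` A)).

Definition disagreement (B : set V) n (A : set X) :=
  [set w | ~ (B (r w) <-> A (z n w))].

(** The event that [z n] lies in [A] can be predicted from [r] with an error tending to 0 in
    measure; the predicting set [B] may change with [n] and [e]. *)
Definition asymptotically_determined (A : set X) := forall e : R, 0 < e ->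
  exists N, forall n, (N <= n)%N ->
    exists2 B, measurable B & (Q (disagreement B n A) < e%:E)%E.

Lemma measurable_disagreement B n A : measurable B -> measurable A ->
  measurable (disagreement B n A).
Proof.
move=> mB mA; have mB' := measurable_preimage r_meas mB.
have mA' := measurable_preimage (z_meas n) mA.
rewrite (_ : disagreement _ _ _ = (r @^-1` B `\` z n @^-1` A)
  `|` (z n @^-1` A `\` r @^-1` B)).
  by apply: measurableU; exact: measurableD.
apply/seteqP; split=> w; rewrite /disagreement/=; last first.
  by move=> [[? ?]|[? ?]] [? ?]; auto.
by move=> nBA; have [Bw|nBw] := pselect (B (r w));
  have [Aw|nAw] := pselect (A (z n w)); tauto.
Qed.

Lemma determined_finite (F : nat -> set X) I (e : R) : 0 < e ->
  (forall i, measurable (F i)) ->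
  (forall i, asymptotically_determined (F i)) ->
  exists N, forall n, (N <= n)%N -> exists2 B : nat -> set V,
    forall i, measurable (B i) &
    (Q [set w | exists2 i, (i < I)%N & disagreement (B i) n (F i) w] < e%:E)%E.
Proof.
move=> + mF dF; elim: I e => [|I IH] e e0.
  exists 0%N => n _; exists (fun=> set0) => //.
  by rewrite (_ : [set w | _] = set0) ?measure0 ?lte_fin// -subset0 => w [].
have e20 : 0 < e / 2 by rewrite divr_gt0.
have [N1 H1] := IH _ e20; have [N2 H2] := dF I _ e20.
exists (maxn N1 N2) => n; rewrite geq_max => /andP[/H1[B mB QB] /H2[C mC QC]].
exists (fun i => if i == I then C else B i); first by move=> i; case: eqP.
have mS : measurable [set w | exists2 i, (i < I)%N & disagreement (B i)
  n (F i) w].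
  rewrite (_ : [set w | _] = \bigcup_(i in [set i | (i < I)%N])
    disagreement (B i) n (F i)).
    by apply: bigcup_measurable => i _; exact: measurable_disagreement.
  by apply/seteqP; split=> w [i iI H]; exists i.
have mC' := measurable_disagreement n mC (mF I).
rewrite [ltRHS](_ : _ = (e / 2)%:E + (e / 2)%:E)%E;
  last by rewrite -EFinD -splitr.
apply: le_lt_trans (lteD QB QC).
apply: (le_trans _ (measureU2 _ mS mC')).
rewrite (_ : [set w | _] = [set w | exists2 i, (i < I)%N & disagreement (B i)
  n (F i) w]
  `|` disagreement C n (F I))//.
apply/seteqP; split=> w /=.
  move=> [i]; rewrite ltnS leq_eqVlt => /orP[/eqP->|iI];
    first by rewrite eqxx; right.
  by rewrite (ltn_eqF iI) => H; left; exists i.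
move=> [[i iI H]|H]; last by exists I; rewrite ?eqxx.
by exists i; rewrite ?(ltn_eqF iI)//; exact: ltnW.
Qed.

(** The asymptotically determined sets form a sigma-algebra. Complements are clear; a countable
    union is replaced by a finite one, and the omitted tail is small uniformly in [n] because all
    [z n] have the same law. *)
Lemma determined_sigma (C : set (set X)) : (@measurable _ X) = <<s C >> ->
  (forall A, C A -> asymptotically_determined A) ->
  forall A, measurable A -> asymptotically_determined A.
Proof.
move=> mXC dC A mA.
suff [] : measurable A /\ asymptotically_determined A by [].
move: A mA; rewrite {1}mXC.
apply: (@smallest_sub _ _ _ [set A | measurable A /\ asymptotically_determined
  A]); last first.
  by move=> A CA; split; [rewrite mXC; exact: sub_sigma_algebra|exact: dC].
split=> [|A [mA dA]|F mdF].
- split=> // e e0; exists 0%N => n _; exists set0 => //.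
  by rewrite (_ : disagreement _ _ _ = set0) ?measure0 ?lte_fin// -subset0 =>
    w; apply.
- rewrite setTD; split; first exact: measurableC.
  move=> e /dA[N dN]; exists N => n /dN[B mB QB].
  exists (~` B); first exact: measurableC.
  rewrite (_ : disagreement _ _ _ = disagreement B n A)//.
  have E w : ((~` B) (r w) <-> (~` A) (z n w)) <-> (B (r w) <-> A (z n w)).
    by rewrite /setC/=; have [?|?] := pselect (B (r w));
      have [?|?] := pselect (A (z n w)); tauto.
  by apply/seteqP; split=> w H H'; apply: H; apply/E.
- have mF i : measurable (F i) by have [] := mdF i.
  have dF i : asymptotically_determined (F i) by have [] := mdF i.
  have mUF : measurable (\bigcup_i F i) by exact: bigcupT_measurable.
  split=> // e e0; have e20 : 0 < e / 2 by rewrite divr_gt0.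
  have [I LI] := tail_small Q (fun i => measurable_preimage (z_meas 0%N)
    (mF i)) e20.
  have [N HN] := determined_finite I e20 mF dF.
  exists N => n /HN[B mB QB].
  have mBI : measurable (\bigcup_(i in [set i | (i < I)%N]) B i) by exact:
    bigcup_measurable.
  exists (\bigcup_(i in [set i | (i < I)%N]) B i) => //.
  pose S := [set w | exists2 i, (i < I)%N & disagreement (B i) n (F i) w].
  pose T' := [set x | (exists i, F i x) /\ forall i, (i < I)%N -> ~ F i x].
  have mT' : measurable T'.
    rewrite (_ : T' = \bigcup_i F i `&` \bigcap_(i in [set i | (i < I)%N])
      ~` F i).
      apply: measurableI => //.
      by apply: bigcap_measurableType => i _; exact: measurableC.
    by apply/seteqP; split=> x [[i Fi]] H; split=> //; exists i.
  have mS : measurable S.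
    rewrite (_ : S = \bigcup_(i in [set i | (i < I)%N]) disagreement (B i)
      n (F i)).
      by apply: bigcup_measurable => i _; exact: measurable_disagreement.
    by apply/seteqP; split=> w [i iI H]; exists i.
  have mzT := measurable_preimage (z_meas n) mT'.
  rewrite [ltRHS](_ : _ = (e / 2)%:E + (e / 2)%:E)%E;
    last by rewrite -EFinD -splitr.
  (* The tail was estimated at time 0; stationarity moves the estimate to time [n]. *)
  rewrite -[X in (Q X < _)%E]/(z 0%N @^-1` T') -(z_law n mT') in LI.
  apply: le_lt_trans (lteD QB LI); apply: (le_trans _ (measureU2 _ mS mzT)).
  rewrite le_measure ?inE//; [exact: measurable_disagreement|exact:
    measurableU|].
  move=> w; rewrite /disagreement/= => dw; apply: contrapT => /not_orP[nS nT].
  apply: dw; split=> [[i iI Bi]|[i _ Fi]].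
    exists i => //; apply: contrapT => nF; apply: nS; exists i => //.
    by move=> [/(_ Bi)].
  have [j jI Fj] : exists2 j, (j < I)%N & F j (z n w).
    apply: contrapT => /forall2NP H; apply: nT; split; first by exists i.
    by move=> j jI Fj; have [] := H j.
  exists j => //; apply: contrapT => nB; apply: nS; exists j => //.
  by move=> [_ /(_ Fj)].
Qed.

End asymptotic_approximation.

(** * Measurability of maps into path spaces and of sets given by formulas *)

Section measurable_paths.
Context d (G : borelGroupType d).

Lemma measurable_coordinate (I : Type) (i : I) :
  measurable_fun setT (fun x : paths G I => x i).
Proof.
move=> _ A mA; rewrite setTI; apply: sub_sigma_algebra.
by exists i => //; exists A => //; rewrite setTI.
Qed.

Lemma measurable_fun_paths d' (X : measurableType d') (I : Type)
    (u : X -> paths G I) :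
  (forall i, measurable_fun setT (fun x => u x i)) -> measurable_fun setT u.
Proof.
move=> mu; apply: (@measurability _ _ _ (paths G I) _ _ (@cylinders _ G I)) =>
  //.
move=> _ [_ [i _ [A mA <-]] <-]; rewrite !setTI.
exact: (measurable_preimage (mu i)).
Qed.

Lemma measurable_shift1 : measurable_fun setT (@shift1 _ G).
Proof. by apply: measurable_fun_paths => i; exact: measurable_coordinate. Qed.

End measurable_paths.

Section measurable_sets.
Context d (X : measurableType d) (R : realType).

Lemma measurable_set_eq (u v : X -> R) :
  measurable_fun setT u -> measurable_fun setT v ->
  measurable [set x | u x = v x].
Proof.
move=> mu mv; have mw := measurable_fun_eqr mu mv.
rewrite (_ : [set x | _] = (fun x => u x == v x) @^-1` [set true]).
  exact: (measurable_preimage mw).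
by apply/seteqP; split=> x /= /eqP.
Qed.

Lemma measurable_set_le (u : X -> R) (c : R) :
  measurable_fun setT u -> measurable [set x | u x <= c].
Proof.
move=> mu; have := measurable_preimage mu (measurable_itv `]-oo, c]).
by congr (measurable _); apply/seteqP; split=> x /=; rewrite in_itv.
Qed.

Lemma measurable_set_ex (J : nat -> set X) :
  (forall n, measurable (J n)) -> measurable [set x | exists n, J n x].
Proof.
move=> mJ; rewrite (_ : [set x | _] = \bigcup_n J n); first exact:
  bigcupT_measurable.
by apply/seteqP; split=> x [n]; exists n.
Qed.

Lemma measurable_set_all (J : nat -> set X) :
  (forall n, measurable (J n)) -> measurable [set x | forall n, J n x].
Proof.
move=> mJ; rewrite (_ : [set x | _] = \bigcap_n J n); first exact:
  bigcapT_measurable.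
by apply/seteqP; split=> [x H n _|x H n]; [exact: H|exact: (H n I)].
Qed.

Lemma measurable_set_impl (p : Prop) (A : set X) :
  measurable A -> measurable [set x | p -> A x].
Proof.
move=> mA; have [hp|np] := pselect p.
  by rewrite (_ : [set x | _] = A)//; apply/seteqP; split=> [x /(_ hp)|x Ax _].
by rewrite (_ : [set x | _] = setT)//; apply/seteqP; split=> // x _ /np.
Qed.

Lemma measurable_set_and (A B : set X) :
  measurable A -> measurable B -> measurable [set x | A x /\ B x].
Proof. exact: measurableI. Qed.

Lemma measurable_set_guard (p : Prop) (A : set X) :
  measurable A -> measurable [set x | p /\ A x].
Proof.
move=> mA; have [hp|np] := pselect p.
  by rewrite (_ : [set x | _] = A)//; apply/seteqP; split=> [x []|].
by rewrite (_ : [set x | _] = set0)// -subset0 => x [].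
Qed.

Lemma measurable_set_eventually (J : nat -> set X) :
  (forall n, measurable (J n)) ->
  measurable [set x | exists N, forall n, (N <= n)%N -> J n x].
Proof.
move=> mJ; apply: measurable_set_ex => N; apply: measurable_set_all => n.
exact: measurable_set_impl.
Qed.

End measurable_sets.

(** * One-sided determination of a coarse metric *)

Section coarse_metrics.
Context (Y : Type) (R : realType).

Definition coarse_metric (C : R) (D : Y -> Y -> R) :=
  (forall x y, D x y <= D y x + C) /\
  (forall x y z, D x z <= D x y + D y z + C).

(** Bookkeeping for all later constants: every concatenation costs one [C], and so does every
    reversal in [coarse_flip]. *)
Lemma coarse_chain C D x y z a b : coarse_metric C D ->
  D x y <= a -> D y z <= b -> D x z <= a + b + C.
Proof.
move=> [_ tri] xy yz; apply: le_trans (tri x y z) _.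
by rewrite lerD2r lerD.
Qed.

Lemma coarse_flip C D x y a : coarse_metric C D ->
  D x y <= a -> D y x <= a + C.
Proof. by move=> [sym _] xy; apply: le_trans (sym y x) _; rewrite lerD2r. Qed.

End coarse_metrics.

Section one_sided.
Context d (G : borelGroupType d) (R : realType)
  dO (Omega : measurableType dO) dY (Y : measurableType dY)
  d1 (B1 : measurableType d1).
Hypothesis G2 : @second_countable G.
Variables (P : probability Omega R) (mu : probability G R).
Hypothesis mu_rmul : forall g : G, nonsingular mu mu (fun x => (x * g)%g).

Local Notation X := (Omega * G)%type.
Local Notation M := (P \x mu)%E.

Variables (path : X -> paths G int) (yy : paths G int -> Y).
Hypotheses (path_meas : measurable_fun setT path)
  (yy_meas : measurable_fun setT yy).
Local Notation y := (fun x : X => yy (path x)).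

Variable aY : G -> Y -> Y.
Hypotheses (aY_act : is_action aY)
  (aY_meas : measurable_fun [set: G * Y] (fun p => aY p.1 p.2))
  (y_equiv : forall h, {ae M, forall x, y (x.1, (h * x.2)%g) = aY h (y x)}).

(** Invariance of [D] is available almost everywhere only, so the points [net i] are taken among
    those at which it holds for almost every group element and almost every second argument. *)
Variables (C : R) (D : Y -> Y -> R) (net : nat -> Y).
Hypotheses (D_coarse : coarse_metric C D)
  (D_meas : measurable_fun [set: Y * Y] (fun p => D p.1 p.2))
  (net_cover : {ae M, forall x, exists i, D (net i) (y x) <= C})
  (net_inv : forall i, {ae mu, forall k, {ae M, forall x,
     D (aY k (net i)) (aY k (y x)) = D (net i) (y x)}}).

(** Both directions of time are treated at once. For the past, [theta] is the inverse of [T], [c w]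
    is [f (Tinv w)], and [kappa n] is [n - 1], the index at which [past] keeps the coordinate [- n].
    For the future, [theta] is [T], [c w] is the inverse of [f w], and [kappa n] is [n]. By
    [path_rho], any coordinate seen from a sufficiently remote time can be read off from [rho] and
    the starting point. *)
Variables (rho : X -> paths G nat) (theta : Omega -> Omega) (c : Omega -> G)
  (kappa : nat -> nat).
Local Notation tau := (fun x : X => (theta x.1, (x.2 * c x.1)%g)).
Hypotheses (rho_meas : measurable_fun setT rho)
  (theta_meas : measurable_fun setT theta)
  (theta_pres : measure_preserving P theta)
  (c_meas : measurable_fun setT c)
  (y_tau : {ae M, forall x, y (tau x) = y x})
  (rho_tau : forall x, rho (tau x) = shift1 (rho x))
  (tau_iter : forall n x, (0 < n)%N ->
     iter n tau x = (iter n theta x.1, (rho x (kappa n))^-1%g))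
  (path_rho : forall i, exists N, forall n, (N <= n)%N -> exists k,
     forall x g, path (iter n theta x.1, g) i =
       (rho x k * (rho x (kappa n))^-1 * g^-1)%g).

Lemma measurable_fun_D dZ (Z : measurableType dZ) (u v : Z -> Y) :
  measurable_fun setT u -> measurable_fun setT v ->
  measurable_fun setT (fun z => D (u z) (v z)).
Proof.
move=> mu' mv; apply: (measurableT_comp D_meas (g := fun z => (u z, v z))).
exact/measurable_fun_pairP.
Qed.

Lemma measurable_fun_aY dZ (Z : measurableType dZ) (u : Z -> G) (v : Z -> Y) :
  measurable_fun setT u -> measurable_fun setT v ->
  measurable_fun setT (fun z => aY (u z) (v z)).
Proof.
move=> mu' mv; apply: (measurableT_comp aY_meas (g := fun z => (u z, v z))).
exact/measurable_fun_pairP.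
Qed.

Lemma measurable_y : measurable_fun setT y.
Proof. exact: (measurableT_comp yy_meas path_meas). Qed.

Lemma theta_nonsingular : nonsingular P P theta.
Proof. by split=> // A mA A0; have := theta_pres mA; rewrite /pushforward =>
  ->. Qed.

Lemma tau_nonsingular : nonsingular M M tau.
Proof.
apply: (nonsingular_prod (m := P) (n := mu) (s := theta)
  (t := fun w g => (g * c w)%g)) => //; first exact: theta_nonsingular.
apply: measurable_fun_mulg => //.
exact: (measurableT_comp c_meas measurable_fst).
Qed.

Lemma y_tau_iter n : {ae M, forall x, y (iter n tau x) = y x}.
Proof.
elim: n => [|n IH]; first exact: aeW.
have := nonsingular_ae (nonsingular_iter n tau_nonsingular) y_tau.
by apply: filterS2 IH => x IH H; rewrite iterS H.
Qed.

Lemma rho_tau_iter n x : rho (iter n tau x) = iter n (@shift1 _ G) (rho x).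
Proof. by elim: n x => [//|n IH] x; rewrite !iterS rho_tau IH. Qed.

(* By invariance of D, a distance to y at time n with an independent start g
   is a distance to y at time 0. *)
Lemma net_transport i n : (0 < n)%N -> {ae (M \x mu)%E, forall p,
  D (aY (p.2 * rho p.1 (kappa n))^-1%g (net i)) (y p.1) =
  D (net i) (y (iter n theta p.1.1, p.2))}.
Proof.
move=> n0; have [act1 actM] := aY_act.
have my2 dZ (Z : measurableType dZ) (u : Z -> Omega) (v : Z -> G) :
    measurable_fun setT u -> measurable_fun setT v ->
    measurable_fun setT (fun z => y (u z, v z)).
  move=> mu' mv; apply: (measurableT_comp measurable_y (g := fun z => (u z,
    v z))).
  exact/measurable_fun_pairP.
have H1 : {ae mu, forall k, {ae M, forall x,
    D (aY k (net i)) (y (x.1, (k * x.2)%g)) = D (net i) (y x)}}.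
  apply: filterS (net_inv i) => k; apply: filterS2 (y_equiv k) => x -> ->.
  by [].
have m21 : measurable_fun setT (fun p : G * X => p.2.1).
  exact: (measurableT_comp measurable_fst measurable_snd).
have m22 : measurable_fun setT (fun p : G * X => p.2.2).
  exact: (measurableT_comp measurable_snd measurable_snd).
have {H1} H2 : {ae M, forall x, {ae mu, forall k,
    D (aY k (net i)) (y (x.1, (k * x.2)%g)) = D (net i) (y x)}}.
  apply: (ae_swap (m := mu) (n := M) (Q := fun k x =>
    D (aY k (net i)) (y (x.1, (k * x.2)%g)) = D (net i) (y x)) _ H1).
  apply: measurable_set_eq; apply: measurable_fun_D.
  - by apply: measurable_fun_aY; [exact: measurable_fst|exact: measurable_cst].
  - by apply: my2 => //; apply: measurable_fun_mulg => //; exact: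
    measurable_fst.
  - exact: measurable_cst.
  - exact: (measurableT_comp measurable_y measurable_snd).
(* For fixed [g'], put [k = g * g'^-1]: right translation preserves null sets, so almost every [k]
   may be replaced by almost every [g]. *)
have {H2} H3 : {ae P, forall w, {ae mu, forall g', {ae mu, forall g,
    D (aY (g * g'^-1)%g (net i)) (y (w, g)) = D (net i) (y (w, g'))}}}.
  pose Q w g' := {ae mu, forall k,
    D (aY k (net i)) (y (w, (k * g')%g)) = D (net i) (y (w, g'))}.
  have : {ae M, forall x, Q x.1 x.2} by apply: filterS H2 => -[w g'].
  move/(ae_prodW (Q := Q)); apply: filterS => w; apply: filterS =>
    g' /(nonsingular_ae (mu_rmul g'^-1%g)).
  by apply: filterS => g; rewrite mulgVK.
have m1 : measurable_fun setT (fun p : X * G => p.1.1).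
  exact: (measurableT_comp measurable_fst measurable_fst).
have m2 : measurable_fun setT (fun p : X * G => p.1.2).
  exact: (measurableT_comp measurable_snd measurable_fst).
have m3 : measurable_fun setT (fun p : X * G => p.2) := measurable_snd.
have mQ : measurable [set p : X * G | D (aY (p.1.2 * p.2^-1)%g (net i))
    (y (p.1.1, p.1.2)) = D (net i) (y (p.1.1, p.2))].
  apply: measurable_set_eq; apply: measurable_fun_D.
  - apply: measurable_fun_aY; last exact: measurable_cst.
    by apply: measurable_fun_mulg => //; exact: measurable_fun_invg.
  - exact: my2.
  - exact: measurable_cst.
  - exact: my2.
(* After exchanging [g] and [g'], the first belongs to the current point [x] and the second is an
   independent start over the same base point. *)
have {H3} H4 : {ae M, forall x, {ae mu, forall g',
    D (aY (x.2 * g'^-1)%g (net i)) (y x) = D (net i) (y (x.1, g'))}}.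
  have : {ae P, forall w, {ae mu, forall g, {ae mu, forall g',
      D (aY (g * g'^-1)%g (net i)) (y (w, g)) = D (net i) (y (w, g'))}}}.
    apply: filterS H3 => w; apply: (ae_swap (Q := fun g' g =>
      D (aY (g * g'^-1)%g (net i)) (y (w, g)) = D (net i) (y (w, g')))).
    apply: measurable_set_eq; apply: measurable_fun_D.
    + apply: measurable_fun_aY; last exact: measurable_cst.
      by apply: measurable_fun_mulg => //; apply: measurable_fun_invg.
    + by apply: my2; [exact: measurable_cst|exact: measurable_snd].
    + exact: measurable_cst.
    + by apply: my2; [exact: measurable_cst|exact: measurable_fst].
  move=> /(ae_prod _ _ (measurable_ae_section mu (Q := fun (x : X) g' =>
    D (aY (x.2 * g'^-1)%g (net i)) (y (x.1, x.2)) = D (net i) (y (x.1, g')))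
      mQ)).
  by apply: filterS => -[w g].
(* Evaluated at [iter n tau x], the current point has group coordinate [(rho x (kappa n))^-1], while
   its value of [y] is still that of [x]. *)
have {H4} H5 := nonsingular_ae (nonsingular_iter n tau_nonsingular) H4.
apply/(ae_prod M mu (Q := fun (x : X) g' =>
   D (aY (g' * rho x (kappa n))^-1%g (net i)) (y x) =
   D (net i) (y (iter n theta x.1, g')))).
  apply: measurable_set_eq; apply: measurable_fun_D.
  - apply: measurable_fun_aY; last exact: measurable_cst.
    apply: measurable_fun_invg => //; apply: measurable_fun_mulg => //.
    exact: (measurableT_comp (measurable_coordinate (kappa n))
      (measurableT_comp rho_meas measurable_fst)).
  - exact: (measurableT_comp measurable_y measurable_fst).
  - exact: measurable_cst.
  - apply: my2 => //.
    exact: (measurableT_comp (nonsingular_iter n theta_nonsingular).1 m1).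
apply: filterS2 (y_tau_iter n) H5 => x yx.
by rewrite yx tau_iter//=; apply: filterS => g' <-; rewrite invgM.
Qed.

(** The map [tau] is only known to preserve null sets. Replacing the group coordinate by an
    independent one makes the law exactly stationary, since [s] preserves [P]; it is enough to
    compare on rectangles. *)
Lemma shifted_law (s : Omega -> Omega) (E : set X) :
  measurable_fun setT s -> measure_preserving P s -> measurable E ->
  (M \x mu)%E ((fun p : X * G => (s p.1.1, p.2)) @^-1` E) = M E.
Proof.
move=> ms sP mE.
have msf : measurable_fun setT (fun x : X => s x.1).
  exact: (measurableT_comp ms measurable_fst).
have mf : measurable_fun setT (fun p : X * G => (s p.1.1, p.2)).
  apply/measurable_fun_pairP; split; last exact: measurable_snd.
  exact: (measurableT_comp msf measurable_fst).
pose m' := measure_function_pushforward__canonical__measure_function_Measure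
  (M \x mu)%E mf.
apply/esym; apply: (@product_measure_unique _ _ _ _ _ P mu m') => // A B mA mB.
have mA' := measurable_preimage msf mA.
transitivity ((M \x mu)%E (((fun x : X => s x.1) @^-1` A) `*` B)) => //.
rewrite product_measure1E//; congr (_ * _)%E.
transitivity ((P \x mu)%E ((s @^-1` A) `*` [set: G])).
  by congr (_ _); apply/seteqP; split=> -[w g] //= [].
rewrite product_measure1E//; last exact: measurable_preimage mA.
transitivity (P (s @^-1` A) * 1)%E; first by congr (_ * _)%E; exact:
  probability_setT.
by rewrite mule1; exact: sP.
Qed.

Lemma iter_theta_pres n : measure_preserving P (iter n theta).
Proof.
elim: n => [|n IH] A mA //.
rewrite -[RHS](IH _ mA) /pushforward.
rewrite (_ : iter n.+1 theta @^-1` A = theta @^-1` (iter n theta @^-1` A)).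
  apply: theta_pres; apply: measurable_preimage mA.
  exact: (nonsingular_iter n theta_nonsingular).1.
by apply/seteqP; split=> w /=; rewrite -iterSr.
Qed.

(** [z n] is the path seen from time [n] with an independent start, and [r] collects what may be
    used to predict it: the one-sided path and that start. *)
Local Notation z := (fun n (p : X * G) => path (iter n theta p.1.1, p.2)).
Local Notation r := (fun p : X * G => (rho p.1, p.2)).
Local Notation V := (paths G nat * G)%type.

Lemma measurable_time n :
  measurable_fun setT (fun p : X * G => (iter n theta p.1.1, p.2)).
Proof.
apply/measurable_fun_pairP; split; last exact: measurable_snd.
apply: (measurableT_comp (nonsingular_iter n theta_nonsingular).1).
exact: (measurableT_comp measurable_fst measurable_fst).
Qed.

Lemma measurable_path_at n : measurable_fun setT (z n).
Proof. exact: (measurableT_comp path_meas (measurable_time n)). Qed.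

Lemma measurable_observed : measurable_fun setT r.
Proof.
apply/measurable_fun_pairP; split; last exact: measurable_snd.
exact: (measurableT_comp rho_meas measurable_fst).
Qed.

Lemma path_at_law n E : measurable E ->
  (M \x mu)%E (z n @^-1` E) = M (path @^-1` E).
Proof.
move=> mE; have mE' := measurable_preimage path_meas mE.
rewrite -(shifted_law (nonsingular_iter n theta_nonsingular).1
  (@iter_theta_pres n) mE').
by [].
Qed.

(** For a cylinder the prediction is exact at all large times by [path_rho]; [determined_sigma]
    extends this to all measurable sets of paths. *)
Lemma path_at_determined E : measurable E ->
  asymptotically_determined (M \x mu)%E z r E.
Proof.
apply: (@determined_sigma _ _ _ _ _ _ _ (M \x mu)%E z r) => //.
- exact: measurable_path_at.
- exact: measurable_observed.
- move=> n A mA; apply: etrans (path_at_law n mA) _.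
  exact: esym (path_at_law 0 mA).
- move=> _ [i _ [A mA <-]] e e0; rewrite setTI.
  have [N HN] := path_rho i; exists N => n /HN[k Hk].
  exists ((fun v : V => (v.1 k * (v.1 (kappa n))^-1 * v.2^-1)%g) @^-1` A).
    apply: measurable_preimage mA; apply: measurable_fun_mulg => //; last first.
      by apply: measurable_fun_invg => //; exact: measurable_snd.
    apply: measurable_fun_mulg => //; last apply: measurable_fun_invg => //.
      exact: (measurableT_comp (measurable_coordinate k) measurable_fst).
    exact: (measurableT_comp (measurable_coordinate (kappa n)) measurable_fst).
  rewrite (_ : disagreement _ _ _ _ _ = set0) ?measure0 ?lte_fin//.
  by rewrite -subset0 => p; rewrite /disagreement/= Hk; apply.
Qed.
Local Notation F := (fun i => [set xi : paths G int | D (net i) (yy xi) <= C]).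

Lemma measurable_net_ball i : measurable (F i).
Proof.
apply: measurable_set_le; apply: measurable_fun_D => //; exact: measurable_cst.
Qed.

(** With small error only the first [I] balls matter, and finitely many balls can be predicted
    simultaneously. The set [bad] collects the wrong predictions and the points first covered by a
    ball of index at least [I]. *)
Lemma net_index_approximation (e : R) : 0 < e -> exists I n (B : nat -> set V),
  [/\ (0 < n)%N, forall i, measurable (B i) & exists bad,
    [/\ measurable bad, ((M \x mu)%E bad <= e%:E)%E &
      forall q, ~ bad q -> (exists i, F i (z n q)) ->
        (exists2 i, (i < I)%N & B i (r q)) /\
        forall i, (i < I)%N -> B i (r q) -> F i (z n q)]].
Proof.
move=> e0; have e20 : 0 < e / 2 by rewrite divr_gt0.
have [I HI] := tail_small M (fun i => measurable_preimage path_meas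
  (measurable_net_ball i)) e20.
have [N HN] := determined_finite measurable_path_at measurable_observed I e20
  measurable_net_ball (fun i => path_at_determined (measurable_net_ball i)).
(* The time [N.+1] rather than [N] is chosen because [net_transport] asks for a positive time. *)
have [B mB QB] := HN N.+1 (leqnSn N).
exists I, N.+1, B; split=> //.
pose T' := [set x | (exists i, F i x) /\ forall i, (i < I)%N -> ~ F i x].
have mT' : measurable T'.
  apply: measurableI; first exact: (measurable_set_ex measurable_net_ball).
  apply: (measurable_set_all (J := fun i => [set x | (i < I)%N -> ~ F i x]))
    => i.
  exact: (measurable_set_impl _ (measurableC (measurable_net_ball i))).
pose S := [set w | exists2 i, (i < I)%N & disagreement z r (B i) N.+1 (F i) w].
have mS : measurable S.
  rewrite (_ : S = [set w | exists i, (i < I)%N /\ disagreement z r (B i)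
    N.+1 (F i) w]).
    apply: (measurable_set_ex (J := fun i => [set w | (i < I)%N /\
      disagreement z r (B i) N.+1 (F i) w])) => i.
    apply: (measurable_set_guard _ (measurable_disagreement measurable_path_at
      measurable_observed N.+1 (mB i) (measurable_net_ball i))).
  by apply/seteqP; split=> w [i]; [exists i|move=> []; exists i].
have mzT := measurable_preimage (measurable_path_at N.+1) mT'.
exists (S `|` z N.+1 @^-1` T'); split; first exact: measurableU.
- apply: le_trans (measureU2 _ mS mzT) _.
  rewrite [leRHS](_ : _ = (e / 2)%:E + (e / 2)%:E)%E;
    last by rewrite -EFinD -splitr.
  apply: leeD; first exact: ltW.
  apply: ltW; exact: (@eq_ind_r _ _ (fun t => (t < _)%E)
    HI _ (path_at_law N.+1 mT')).
- move=> q /not_orP[nS nT] exF; split=> [|i iI Bi]; last first.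
    apply: contrapT => nF; apply: nS; exists i => //.
    by move=> [/(_ Bi)].
  have [i iI Fi] : exists2 i, (i < I)%N & F i (z N.+1 q).
    apply: contrapT => /forall2NP H; apply: nT; split=> //.
    by move=> j jI Fj; have [] := H j.
  exists i => //; apply: contrapT => nB; apply: nS; exists i => //.
  by move=> [_ /(_ Fi)].
Qed.

(** At times [n m] with summable errors, the predicted net points, transported back to time 0, are
    eventually within [C] of [y]. Whether [y] is near [y0] can therefore be tested on these points,
    which depend on [rho] and the auxiliary start only. *)
Lemma determined_level (y0 : Y) : exists U : set (paths G nat),
  measurable U /\ {ae M, forall x,
    (D y0 (y x) <= C -> U (rho x)) /\ (U (rho x) -> D y0 (y x) <= C *+ 6)}.
Proof.
have e0 m : (0 : R) < 1 / (2 ^ m.+1)%:R.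
  by rewrite divr_gt0// ltr0n expn_gt0.
have /choice[I /choice[n /choice[B HB]]] m := net_index_approximation (e0 m).
(* This is the translation by which [net_transport] brings a net point from time [n m] back to time
   0. *)
pose k m (v : V) := (v.2 * v.1 (kappa (n m)))^-1%g.
pose U' := [set v : V | exists N, forall m, (N <= m)%N ->
  exists i, (i < I m)%N /\ (B m i v /\ D y0 (aY (k m v) (net i)) <= C *+ 4)].
have mU' : measurable U'.
  apply: measurable_set_eventually => m.
  apply: (measurable_set_ex (J := fun i => [set v | (i < I m)%N /\ (B m i v /\
    D y0 (aY (k m v) (net i)) <= C *+ 4)])) => i.
  apply: (measurable_set_guard _ (A := [set v | B m i v /\ D y0 (aY (k m v)
    (net i)) <= C *+ 4])).
  apply: measurable_set_and; first by have [] := HB m.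
  apply: measurable_set_le; apply: measurable_fun_D; first exact:
    measurable_cst.
  apply: measurable_fun_aY; last exact: measurable_cst.
  apply: measurable_fun_invg => //; apply: measurable_fun_mulg => //.
  exact: (measurableT_comp (measurable_coordinate _) measurable_fst).
have HB' m : {ae (M \x mu)%E, forall q, forall i,
    D (aY (k m (r q)) (net i)) (y q.1) = D (net i) (y (iter (n m) theta q.1.1,
      q.2))}.
  have [n0 _ _] := HB m.
  apply: ae_foralln => i.
  exact: net_transport.
have exF m : {ae (M \x mu)%E, forall q, exists i, F i (z (n m) q)}.
  have mF : measurable [set xi | exists i, F i xi] by exact:
    (measurable_set_ex measurable_net_ball).
  apply/(negligibleP (M \x mu)%E); first exact:
    (measurableC (measurable_preimage (measurable_path_at (n m)) mF)).
  rewrite -[X in (M \x mu)%E X = _]/(z (n m) @^-1` (~` [set xi | exists i,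
    F i xi])).
  apply: etrans (path_at_law (n m) (measurableC mF)) _.
  by apply/negligibleP; [exact: (measurableC (measurable_preimage path_meas
    mF))|exact: net_cover].
have /choice[bad badP] m : exists bad, [/\ measurable bad,
    ((M \x mu)%E bad <= (1 / (2 ^ m.+1)%:R)%:E)%E &
    forall q, ~ bad q -> (exists i, F i (z (n m) q)) ->
        (exists2 i, (i < I m)%N & B m i (r q)) /\
        forall i, (i < I m)%N -> B m i (r q) -> F i (z (n m) q)].
  by have [] := HB m.
have bc := borel_cantelli_ae (m := (M \x mu)%E) (fun m => let: And3 H _ _ :=
  badP m in H)
  (fun m => let: And3 _ H _ := badP m in H).
have key : {ae (M \x mu)%E, forall q,
    (D y0 (y q.1) <= C -> U' (r q)) /\ (U' (r q) -> D y0 (y q.1) <= C *+ 6)}.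
  move/ae_foralln in HB'; move/ae_foralln in exF.
  apply: filterS3 HB' exF bc => q tr ex [N HN].
  have good m : (N <= m)%N -> (exists2 i, (i < I m)%N & B m i (r q)) /\
      forall i, (i < I m)%N -> B m i (r q) -> D (aY (k m (r q)) (net i))
        (y q.1) <= C.
    move=> /HN nbad; have [_ _ /(_ q nbad (ex m))[exB BF]] := badP m.
    by split=> // i iI /(BF i iI); rewrite /= tr.
  split=> [le|[N' HN']].
    (* The 4 is [C] from [y0] to [y], twice [C] from [y] to the predicted point after reversal, and
       one [C] for concatenation. Conversely 4 + 1 + 1 gives the 6. *)
    exists N => m /good[[i iI Bi] /(_ i iI Bi) le2]; exists i; split=> //;
      split=> //.
    apply: le_trans (coarse_chain D_coarse le (coarse_flip D_coarse le2)) _.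
    by rewrite !mulrS mulr0n addr0 !addrA lexx.
  have [_ leC] := good (maxn N N') (leq_maxl _ _).
  have [i [iI [Bi le]]] := HN' (maxn N N') (leq_maxr _ _).
  apply: le_trans (coarse_chain D_coarse le (leC _ iI Bi)) _.
  by rewrite -mulrSr -mulrSr.
(* Freezing the auxiliary start at a value good for almost every [x] leaves a condition on [rho x]
   alone. *)
have [g Hg] := ae_witness (ae_prodW_swap (Q := fun x g =>
  (D y0 (y x) <= C -> U' (rho x, g)) /\ (U' (rho x, g) -> D y0 (y x) <=
    C *+ 6)) key).
exists [set xi | U' (xi, g)]; split=> //.
apply: measurable_preimage mU'; apply/measurable_fun_pairP; split.
  exact: measurable_id.
exact: measurable_cst.
Qed.
Variable bnd1 : paths G nat -> B1.
Hypothesis bnd1_invariant : forall V0 : set (paths G nat), measurable V0 ->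
  (forall xi, V0 (shift1 xi) <-> V0 xi) ->
  exists2 W, measurable W & {ae M, forall x, V0 (rho x) <-> W (bnd1 (rho x))}.

(** The set [U] need not be shift-invariant, but the set of paths whose shifts eventually stay in
    [U] is. Since [y] is constant along the orbits of [tau], the two implications for [U] pass to
    this set, which the boundary map detects. *)
Lemma boundary_level (y0 : Y) : exists W : set B1,
  measurable W /\ {ae M, forall x,
    (D y0 (y x) <= C -> W (bnd1 (rho x))) /\
    (W (bnd1 (rho x)) -> D y0 (y x) <= C *+ 6)}.
Proof.
have [U [mU UP]] := determined_level y0.
pose V0 := [set xi | exists N, forall n, (N <= n)%N -> U (iter n (@shift1 _ G)
  xi)].
have ms n : measurable_fun setT (iter n (@shift1 _ G)).
  elim: n => [|n IH]; first exact: measurable_id.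
  exact: (measurableT_comp (measurable_shift1 (G := G)) IH).
have mV0 : measurable V0.
  apply: measurable_set_eventually => n; exact: (measurable_preimage (ms n) mU).
have V0s xi : V0 (shift1 xi) <-> V0 xi.
  split=> -[N HN].
    by exists N.+1 => -[//|n] Nn; rewrite iterSr; exact: HN.
  by exists N => n Nn; rewrite -iterSr; apply: HN; exact: leqW.
have [W mW VW] := bnd1_invariant mV0 V0s.
exists W; split=> //.
have UPn : {ae M, forall x, forall n,
   (D y0 (y (iter n tau x)) <= C -> U (rho (iter n tau x))) /\
   (U (rho (iter n tau x)) -> D y0 (y (iter n tau x)) <= C *+ 6)}.
  apply: ae_foralln => n.
  exact: (nonsingular_ae (nonsingular_iter n tau_nonsingular) UP).
have yn : {ae M, forall x, forall n, y (iter n tau x) = y x}.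
  by apply: ae_foralln => n; exact: y_tau_iter.
apply: filterS3 VW UPn yn => x VWx Ux yx; split.
  move=> le; apply/VWx; exists 0%N => n _; rewrite -rho_tau_iter.
  by apply: (Ux n).1; rewrite yx.
move=> /VWx[N /(_ N (leqnn N))]; rewrite -rho_tau_iter => /(Ux N).2.
by rewrite yx.
Qed.

End one_sided.

(** * From rigidity to metric and coarse metric ergodicity *)

Lemma open_mdist_lt (R : realType) (Z : metricType R) (s : Z) (c : R) :
  open [set z | mdist s z < c].
Proof.
rewrite openE => z /= sz; apply/nbhs_ballP; exists (c - mdist s z).
  by rewrite /= subr_gt0.
move=> w; rewrite ballEmdist/= => zw; apply:
  le_lt_trans (metric_triangle s z w) _.
by rewrite -ltrBrDl.
Qed.

Section measurable_below.
Context d (X : measurableType d) (R : realType).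

Lemma measurable_fun_below (u : X -> R) :
  (forall c, measurable [set x | u x < c]) -> measurable_fun setT u.
Proof.
move=> mu; apply: (@measurability _ _ _ _ _ _ (@RGenInftyO.G R)).
  exact: RGenInftyO.measurableE.
move=> _ [_ [c ->] <-].
by rewrite setTI; have := mu c; congr (measurable _); apply/seteqP; split=>
  x /=;
  rewrite in_itv.
Qed.

Lemma measurable_set_lt (u : X -> R) (c : R) :
  measurable_fun setT u -> measurable [set x | u x < c].
Proof.
move=> mu; have := measurable_preimage mu (measurable_itv `]-oo, c[).
by congr (measurable _); apply/seteqP; split=> x /=; rewrite in_itv.
Qed.

End measurable_below.

Section measurable_mdist.
Context d (X : measurableType d) (R : realType).

Lemma dense_enum (Z : metricType R) (z0 : Z) : separable Z ->
  exists s : nat -> Z, forall z e, 0 < e -> exists n, mdist (s n) z < e.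
Proof.
move=> [S cS dS].
have [s0 [_ Ss0]] : setT `&` S !=set0.
  by apply: dS; [exists z0|exact: openT].
have [s [_ sS]] := countable_enum Ss0 cS.
exists s => z e e0; have [|z' [zz' /sS[n sn]]] := dS _ _ (open_mdist_lt z e).
  by exists z; rewrite /= mdistxx.
by exists n; rewrite sn metric_sym.
Qed.

(** A distance is below [c] exactly when some term of a dense sequence has distances to the two
    points adding up to less than [c]; this is a countable union of conditions on one variable at a
    time. *)
Lemma measurable_fun_mdist (Z : metricType R) (F : X -> Z) (x0 : X) :
  separable Z ->
  (forall U : set Z, open U -> measurable (F @^-1` U)) ->
  measurable_fun [set: X * X] (fun p => mdist (F p.1) (F p.2)).
Proof.
move=> sepZ mF; have [s sP] := dense_enum (F x0) sepZ.
have ms n : measurable_fun setT (fun x => mdist (s n) (F x)).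
  by apply: measurable_fun_below => c; exact: mF _ (open_mdist_lt (s n) c).
apply: measurable_fun_below => c.
rewrite (_ : [set p | _] = [set p | exists n,
    mdist (s n) (F p.1) + mdist (s n) (F p.2) < c]).
  apply: (measurable_set_ex (J := fun n => [set p : X * X |
    mdist (s n) (F p.1) + mdist (s n) (F p.2) < c])) => n.
  have mD : measurable_fun setT (fun p : X * X => mdist (s n) (F p.1)
    + mdist (s n) (F p.2)).
    apply: measurable_funD; first exact: (measurableT_comp (ms n)
      measurable_fst).
    exact: (measurableT_comp (ms n) measurable_snd).
  exact: measurable_set_lt.
apply/seteqP; split=> [p /= lt|p /= [n lt]]; last first.
  apply: le_lt_trans lt; rewrite (metric_sym (s n) (F p.1)).
  exact: metric_triangle.
have e0 : 0 < (c - mdist (F p.1) (F p.2)) / 2 by rewrite divr_gt0// subr_gt0.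
have [n sn] := sP (F p.1) _ e0; exists n.
have := metric_triangle (s n) (F p.1) (F p.2).
set a := mdist (s n) (F p.1) in sn *; set b := mdist (F p.1) (F p.2) in sn e0 *.
by lra.
Qed.

End measurable_mdist.

Section rigidity.
Context d (G : borelGroupType d) (R : realType).
Context dY (Y : measurableType dY) (eta : probability Y R) (a : G -> Y -> Y).

(* The constant 21 is immaterial. What matters is that the bound is linear in
   C, so that for a metric the hypotheses may be applied with all C > 0. *)
Definition coarsely_rigid := forall (C : R) (D : Y -> Y -> R),
  coarse_metric C D ->
  measurable_fun [set: Y * Y] (fun p => D p.1 p.2) ->
  (forall g, {ae (eta \x eta)%E, forall p, D (a g p.1) (a g p.2) = D p.1 p.2})
    ->
  {ae eta, forall y, ~ {ae eta, forall x, ~ D x y <= C}} ->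
  exists y0, {ae eta, forall y, D y0 y <= C *+ 21}.

Lemma rigid_metrically_ergodic : coarsely_rigid -> metrically_ergodic eta a.
Proof.
move=> rigid Z aZ F sepZ actZ isoZ mF eqF.
have [y _] : exists y : Y, True by apply: (ae_witness (m := eta)); exact: aeW.
have [s sP] := dense_enum (F y) sepZ.
pose D x x' := mdist (F x) (F x').
have mD : measurable_fun [set: Y * Y] (fun p => D p.1 p.2).
  exact: (measurable_fun_mdist y sepZ mF).
have /choice[u uP] n : exists y0, {ae eta, forall y, D y0 y <=
  n.+1%:R^-1 *+ 21}.
  have n0 : (0 : R) < n.+1%:R^-1 by rewrite invr_gt0.
  apply: rigid => //.
  - split=> [x x'|x x' x''].
      by rewrite /D metric_sym lerDl ltW.
    by apply: le_trans (metric_triangle _ (F x') _) _; rewrite lerDl ltW.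
  - move=> g; have := eqF g => H.
    apply: filterS2 (ae_fst eta H) (ae_snd eta H) => p e1 e2.
    by rewrite /D e1 e2 isoZ.
  (* Among the countably many balls of half the radius around the dense points, those with null
     preimage are discarded; any other such ball around [F x] lies in the ball of full radius at
     [F x]. *)
  - have n20 : (0 : R) < n.+1%:R^-1 / 2 by rewrite divr_gt0.
    pose Bk k := [set y' | mdist (s k) (F y') < n.+1%:R^-1 / 2].
    have mB k : measurable (Bk k) by exact: mF _ (open_mdist_lt _ _).
    have : {ae eta, forall y, forall k, Bk k y -> ~ {ae eta, forall x,
      ~ Bk k x}}.
      apply: ae_foralln => k.
      have [nul|pos] := pselect {ae eta, forall x, ~ Bk k x}.
        by apply: filterS nul => x nB /nB.
      exact: aeW.
    apply: filterS => x Bx Dx; have [k skx] := sP (F x) _ n20.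
    apply: (Bx k skx); apply: filterS Dx => x' Dx' Bx'; apply: Dx'.
    apply: le_trans (metric_triangle _ (s k) _) _; rewrite metric_sym.
    by rewrite [leRHS]splitr lerD// ltW.
have [z Hz] := ae_witness (ae_foralln uP).
exists (F z); apply: filterS (ae_foralln uP) => x Hx.
apply/esym/mdist_positivity/eqP; rewrite eq_le mdist_ge0 andbT.
apply/ler_addgt0Pl => e e0; rewrite addr0.
(* Both [x] and [z] are within 21 times the inverse of [n.+1] from [u n], hence 42. *)
have e420 : 0 < e / 42 by rewrite divr_gt0.
have [n] := ltr_add_invr e420; rewrite add0r => ne.
apply: le_trans (metric_triangle _ (F (u n)) _) _; rewrite (metric_sym (F z)).
have := Hz n; have := Hx n; rewrite /D.
move=> le1 le2; apply: le_trans (lerD le2 le1) _.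
by rewrite -mulrnDr -[leLHS]mulr_natr -ler_pdivlMr// ltW.
Qed.

Hypotheses (a_act : is_action a)
  (a_meas : measurable_fun [set: G * Y] (fun p => a p.1 p.2))
  (a_nonsingular : forall g, nonsingular eta eta (a g)).

Lemma rigid_coarsely_metrically_ergodic :
  coarsely_rigid -> coarsely_metrically_ergodic eta a.
Proof.
move=> rigid Y' D mY' Y'0 [D0 [C C0 [Dxx Dsym Dtri]]] mD Dinv.
have [act1 actM] := a_act.
have aeY' : {ae eta, forall x, Y' x}.
  by exists (~` Y'); split => //; exact: measurableC.
have [y' Y'y'] := ae_witness aeY'.
(* A retraction onto [Y'], with default [y'], makes the coarse metric total without changing it on a
   conull set. *)
pose k x := if x \in Y' then x else y'.
have Y'k x : Y' (k x) by rewrite /k; case: ifPn => // /set_mem.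
have kE x : Y' x -> k x = x by move=> Y'x; rewrite /k mem_set.
have mk : measurable_fun setT k.
  move=> _ A mA; rewrite setTI.
  have mA1 : measurable (Y' `&` A) by exact: measurableI.
  have mA2 : measurable [set x | A y' /\ (~` Y') x].
    by apply: measurable_set_guard; exact: measurableC.
  rewrite (_ : _ @^-1` _ = (Y' `&` A) `|` [set x | A y' /\ (~` Y') x]).
    exact: measurableU.
  apply/seteqP; split=> x; rewrite /= /k.
    by case: ifPn => [/set_mem|/negP nY' Ay']; [left|right; split=> // Yx;
      apply: nY'; exact: mem_set].
  by move=> [[Yx Ax]|[Ay' nYx]]; [rewrite mem_set|rewrite memNset].
pose D' x x' := D (k x) (k x').
have mD' : measurable_fun [set: Y * Y] (fun p => D' p.1 p.2).
  apply: (measurable_comp (F := Y' `*` Y') _ _ mD (g := fun p => (k p.1,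
    k p.2))).
  - exact: measurableX.
  - by move=> _ [p _ <-]; split; exact: Y'k.
  - apply/measurable_fun_pairP; split; first exact:
    (measurableT_comp mk measurable_fst).
    exact: (measurableT_comp mk measurable_snd).
have D'inv g : {ae (eta \x eta)%E, forall p, D' (a g p.1) (a g p.2) =
  D' p.1 p.2}.
  have aeg : {ae eta, forall x, Y' x /\ Y' (a g x)}.
    exact: (filterI aeY' (nonsingular_ae (a_nonsingular g) aeY')).
  apply: filterS2 (ae_fst eta aeg) (ae_snd eta aeg) => p [Y1 Y1'] [Y2 Y2'].
  by rewrite /D' !kE//; exact: Dinv.
have D'C C' : C <= C' -> coarse_metric C' D'.
  move=> CC'; split=> [x x'|x x' x''].
    by apply: le_trans (Dsym _ _ (Y'k x) (Y'k x')) _; rewrite lerD2l.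
  by apply: le_trans (Dtri _ (k x') _ _ _ _) _; rewrite ?lerD2l.
(* The points whose balls of radius [L] have positive measure; the encoding avoids naming the
   ball. *)
pose E (L : nat) := [set x | ~ {ae eta, forall x', ~ D' x' x <= L%:R}].
have mE L : measurable (E L).
  apply: measurableC; apply: (measurable_ae_section eta (Q := fun x x' =>
    ~ D' x' x <= L%:R)).
  apply: measurableC; apply: measurable_set_le.
  apply: (measurableT_comp mD' (g := fun p : Y * Y => (p.2, p.1))).
  by apply/measurable_fun_pairP; split; [exact: measurable_snd|exact:
    measurable_fst].
have Einv L g : {ae eta, forall x, E L (a g x) <-> E L x}.
  apply: filterS (ae_prodW_swap (Q := fun x x' => D' (a g x) (a g x') =
    D' x x') (D'inv g)) => x Dg.
  split; apply: contra_not => nD.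
    have H : {ae eta, forall x', ~ D' (a g x') (a g x) <= L%:R}.
      by apply: filterS2 Dg nD => x' ->.
    have := nonsingular_ae (a_nonsingular g^-1%g) H.
    by apply: filterS => x'; rewrite -actM mulgV act1.
  have := nonsingular_ae (a_nonsingular g) nD.
  by apply: filterS2 Dg => x' ->.
have E01 L : {ae eta, forall x, ~ E L x} \/ {ae eta, forall x, E L x}.
  have [nul|pos] := pselect {ae eta, forall x, ~ E L x}; first by left.
  have [nul|pos'] := pselect {ae eta, forall x, E L x}; first by right.
  (* The 0-1 pseudometric separating [E L] from its complement. When neither of the two is null,
     every ball of radius below 1 has positive measure and rigidity applies. *)
  pose D1 x x' : R := (x \in E L != (x' \in E L))%:R.
  have D1E x x' : (E L x <-> E L x') -> D1 x x' = 0.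
    move=> H; rewrite /D1 (_ : (x \in E L) = (x' \in E L)) ?eqxx//.
    by apply/idP/idP => /set_mem/H/mem_set.
  have mD1 : measurable_fun [set: Y * Y] (fun p => D1 p.1 p.2).
    apply: measurable_fun_below => c.
    have m1 : measurable [set p : Y * Y | E L p.1 <-> E L p.2].
      have m1 := measurable_preimage (@measurable_fst _ _ Y Y) (mE L).
      have m2 := measurable_preimage (@measurable_snd _ _ Y Y) (mE L).
      rewrite (_ : [set p | _] = ((fst @^-1` E L) `&` (snd @^-1` E L)) `|`
        (~` (fst @^-1` E L) `&` ~` (snd @^-1` E L))).
        by apply: measurableU; apply: measurableI => //; exact: measurableC.
      apply/seteqP; split=> p /=; last by tauto.
      by have [?|?] := pselect (E L p.1); have [?|?] := pselect (E L p.2);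
        tauto.
    rewrite (_ : [set x | _] = [set p | 0 < c /\ (E L p.1 <-> E L p.2)] `|`
      [set p | 1 < c /\ (~` [set p : Y * Y | E L p.1 <-> E L p.2]) p]).
      apply: measurableU; first exact: measurable_set_guard.
      by apply: measurable_set_guard; exact: measurableC.
    apply/seteqP; split=> p /=.
      have [H|H] := pselect (E L p.1 <-> E L p.2); first by rewrite D1E//; left.
      rewrite /D1 (_ : (p.1 \in E L != (p.2 \in E L)) = true); first by right.
      apply/negP => /eqP e; apply: H.
      by split=> /mem_set; [rewrite e|rewrite -e] => /set_mem.
    move=> [[c0 H]|[c1 _]]; first by rewrite D1E.
    by apply: le_lt_trans c1; rewrite /D1; case: (_ != _).
  (* With the constant [1 / 42] the bound is [1 / 2], which forces the 0-1 value to be 0, so almost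
     every point lies on the same side as [y0]. *)
  have [y0 Hy0] : exists y0, {ae eta, forall y, D1 y0 y <= 42^-1 *+ 21}.
    apply: rigid => //.
    - split=> [x x'|x x' x''].
        by rewrite /D1 eq_sym lerDl invr_ge0.
      rewrite /D1; case: (x \in E L); case: (x' \in E L); case: (x'' \in E L);
        rewrite /= ?addr0 ?add0r; lra.
    - move=> g; have := Einv L g => Eg.
      apply: filterS2 (ae_fst eta Eg) (ae_snd eta Eg) => p e1 e2.
      rewrite /D1; congr ((_ != _)%:R); apply/idP/idP => /set_mem;
        by [move=> /e1/mem_set|move=> /e2/mem_set].
    - apply: aeW => x H; have [Ex|nEx] := pselect (E L x).
        apply: pos; apply: filterS H => x'; apply: contra_not => Ex'.
        by rewrite D1E// invr_ge0.
      apply: pos'; apply: filterS H => x' H; apply: contrapT => nEx'; apply: H.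
      by rewrite D1E// invr_ge0.
  have E0 : {ae eta, forall y, (E L y0 <-> E L y)} -> False.
    move=> H; have [Ey0|nEy0] := pselect (E L y0).
      by apply: pos'; apply: filterS H => x [+ _]; apply.
    by apply: pos; apply: filterS H => x [_ H] /H.
  exfalso; apply: E0; apply: filterS Hy0 => x; rewrite /D1.
  case: eqP => [e _|_]; last by rewrite /=; lra.
  by split=> /mem_set; [rewrite e|rewrite -e] => /set_mem.
(* If every [E L] were null, some [x] would have only null balls of integer radius, and these
   exhaust the space. *)
have [L EL] : exists L, {ae eta, forall x, E L x}.
  apply: contrapT => /forallNP nE.
  have [x Hx] : exists x, forall L, ~ E L x.
    apply: (ae_witness (m := eta)); apply: ae_foralln => L.
    by have [//|/nE] := E01 L.
  have [x' Hx'] : exists x', forall L : nat, ~ D' x' x <= L%:R.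
    apply: (ae_witness (m := eta)); apply: ae_foralln => L; exact:
      (contrapT (Hx L)).
  apply: (Hx' (Num.truncn (D' x' x)).+1); apply: ltW; exact: truncnS_gt.
pose C' := Num.max C L%:R.
have CC' : C <= C' by rewrite le_max lexx.
have [y0 Hy0] : exists y0, {ae eta, forall y, D' y0 y <= C' *+ 21}.
  apply: rigid => //; first exact: D'C.
  apply: filterS EL => x; apply: contra_not; apply: filterS => x'; apply:
    contra_not => le.
  by apply: le_trans le _; rewrite le_max lexx orbT.
have C'0 : 0 < C' by apply: lt_le_trans CC'.
(* Through [y0]: 22 after reversal, 21 directly, and 1 for concatenation. *)
exists (C' *+ 44); first by rewrite mulrn_wgt0.
have H : {ae eta, forall x, Y' x /\ D' y0 x <= C' *+ 21} by exact: filterI.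
apply: filterS2 (ae_fst eta H) (ae_snd eta H) => p [Y1 le1] [Y2 le2].
have := coarse_chain (D'C _ CC') (coarse_flip (D'C _ CC') le1) le2.
rewrite /D' !kE// => /le_trans; apply.
by rewrite -mulrSr -mulrnDr -mulrSr.
Qed.

End rigidity.

(** * The two boundaries *)

Lemma nonsingular_actionW d (G : borelGroupType d) (R : realType)
    dY (Y : measurableType dY) (eta : probability Y R) (a : G -> Y -> Y) :
  nonsingular_action eta a -> forall g, nonsingular eta eta (a g).
Proof.
move=> [_ ma nsa] g; split.
  apply: (measurableT_comp ma (g := fun y => (g, y))).
  by apply/measurable_fun_pairP; split; [exact: measurable_cst|exact:
    measurable_id].
move=> A mA A0; have [nsA _] := nsa g; apply: (nsA A) => //.
exact/measure0_null_setP.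
Qed.

(** The interiors of the balls with centres in a dense sequence and radii [1 / (n + 1)] separate the
    points of a Hausdorff space. Almost sure equality of maps into [T] thereby reduces to countably
    many indicator functions. *)
Lemma standard_borel_separating (R : realType) d (T : measurableType d) :
  standard_borel R T -> exists A : nat -> set T,
    (forall n, measurable (A n)) /\
    forall x y, (forall n, A n x <-> A n y) -> x = y.
Proof.
move=> [X [h [hX [S cS dS] bh mh]]].
have [S0|[s0 Ss0]] : S = set0 \/ S !=set0.
- by have [|/set0P] := eqVneq S set0; [left|right].
(* An empty dense set means that the space itself is empty. *)
- exists (fun=> set0); split=> // x.
  have [||s []] := dS setT; [by exists (h x)|exact: openT|].
  by rewrite S0.
have [s [_ sS]] := countable_enum Ss0 cS.
pose U (p : nat * nat) := (ball (s p.1) p.2.+1%:R^-1)°.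
pose A n := h @^-1` (if unpickle n is Some p then U p else set0).
have [hi hK Kh] := bh.
have mA n : measurable (A n).
  apply/mh; have -> : h @` A n = if unpickle n is Some p then U p else set0.
    apply/seteqP; split=> z; first by move=> [x Ax <-].
    by move=> Uz; exists (hi z); rewrite /A/= ?Kh.
  case: unpickle => [p|]; apply: sub_sigma_algebra; last exact: open0.
  exact: open_interior.
exists A; split=> // x y Axy; apply: (can_inj hK); apply: hX => V W Vx Wy.
have [/= e e0 eV] := (nbhs_ballP _ _).1 Vx.
have [/= e' e'0 eW] := (nbhs_ballP _ _).1 Wy.
have m0 : 0 < Num.min e e' by rewrite lt_min e0.
have [k] := ltr_add_invr m0; rewrite add0r lt_min => /andP[ke ke'].
have r0 : 0 < k.+1%:R^-1 / 2 :> R by rewrite divr_gt0.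
have [||z [zx /sS[n sn]]] := dS (ball (h x) (k.+1%:R^-1 / 2))°.
- by exists (h x); exact: nbhsx_ballx.
- exact: open_interior.
rewrite -{z}sn in zx *; have {}zx := interior_subset zx.
have Ux : U (n, k) (h x).
  apply/nbhs_ballP; exists (k.+1%:R^-1 / 2) => // w xw.
  by rewrite [X in ball _ X](splitr k.+1%:R^-1) /=; apply:
    ball_triangle (ball_sym zx) xw.
have Uy : U (n, k) (h y).
  by have := (Axy (pickle (n, k))).1; rewrite /A/= pickleK; apply.
exists (s n); split.
  apply: eV; apply: le_ball zx; apply: le_trans (ltW ke).
  by rewrite ler_pdivrMr// ler_peMr// ler1n.
by apply: eW; apply: le_ball (ball_sym (interior_subset Uy)); exact: ltW.
Qed.

Section two_boundaries.
Context dX (X : measurableType dX) dm (Bm : measurableType dm)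
  dp (Bp : measurableType dp) (R : realType).
Variables (M : probability X R) (num : probability Bm R) (nup :
  probability Bp R).
Variables (y : X -> Bm * Bp) (C : R) (D : Bm * Bp -> Bm * Bp -> R)
  (net : nat -> Bm * Bp).
Hypotheses (y_null : forall A, measurable A ->
    M (y @^-1` A) = 0%E -> (num \x nup)%E A = 0%E)
  (y_meas : measurable_fun setT y)
  (D_coarse : coarse_metric C D)
  (D_meas : measurable_fun [set: (Bm * Bp) * (Bm * Bp)] (fun p => D p.1 p.2))
  (net_cover : {ae M, forall x, exists i, D (net i) (y x) <= C}).
Hypotheses
  (past_level : forall y0, exists W : set Bm, measurable W /\ {ae M, forall x,
    (D y0 (y x) <= C -> W (y x).1) /\ (W (y x).1 -> D y0 (y x) <= C *+ 6)})
  (future_level : forall y0, exists W : set Bp, measurable W /\ {ae M, forall x,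
    (D y0 (y x) <= C -> W (y x).2) /\ (W (y x).2 -> D y0 (y x) <= C *+ 6)}).

(** Fix a generic second coordinate [b2]; it is attached to one index [j], so almost all points
    [(b1', b2)] are near [net j]. The points [(b1', b2)] and [(b1', b2')] share their first
    coordinate, hence are near a common [net i]. *)
Lemma product_bound : exists y0, {ae (num \x nup)%E, forall b, D y0 b <=
  C *+ 21}.
Proof.
have /choice[Wm /all_and2[mWm WmP]] i := past_level (net i).
have /choice[Wp /all_and2[mWp WpP]] i := future_level (net i).
pose Q b1 b2 := ((exists i, Wm i b1) /\ (exists i, Wp i b2)) /\
  ((forall i, Wm i b1 -> D (net i) (b1, b2) <= C *+ 6) /\
   (forall i, Wp i b2 -> D (net i) (b1, b2) <= C *+ 6)).
have mQ : measurable [set b : Bm * Bp | Q b.1 b.2].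
  have m1 i : measurable [set b : Bm * Bp | Wm i b.1].
    exact: (measurable_preimage measurable_fst (mWm i)).
  have m2 i : measurable [set b : Bm * Bp | Wp i b.2].
    exact: (measurable_preimage measurable_snd (mWp i)).
  have mD i : measurable [set b : Bm * Bp | D (net i) (b.1, b.2) <= C *+ 6].
    apply: measurable_set_le.
    apply: (measurableT_comp D_meas (g := fun b : Bm * Bp => (net i, (b.1,
      b.2)))).
    apply/measurable_fun_pairP; split; first exact: measurable_cst.
    by apply/measurable_fun_pairP; split; [exact: measurable_fst|exact:
      measurable_snd].
  have mI (A B : nat -> set (Bm * Bp)) i : measurable (A i) ->
    measurable (B i) ->
      measurable [set b | A i b -> B i b].
    move=> mA mB; rewrite (_ : [set b | _] = ~` A i `|` B i).
      by apply: measurableU => //; exact: measurableC.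
    apply/seteqP; split=> b /=; last by move=> [nA /nA|Bb _].
    by have [Ab /(_ Ab)|nAb _] := pselect (A i b); [right|left].
  apply: measurable_set_and; apply: measurable_set_and.
  - exact: (measurable_set_ex m1).
  - exact: (measurable_set_ex m2).
  - apply: (measurable_set_all (J := fun i => [set b : Bm * Bp |
      Wm i b.1 -> D (net i) (b.1, b.2) <= C *+ 6])) => i.
    exact: (mI (fun i => [set b : Bm * Bp | Wm i b.1])
      (fun i => [set b : Bm * Bp | D (net i) (b.1, b.2) <= C *+ 6])).
  - apply: (measurable_set_all (J := fun i => [set b : Bm * Bp |
      Wp i b.2 -> D (net i) (b.1, b.2) <= C *+ 6])) => i.
    exact: (mI (fun i => [set b : Bm * Bp | Wp i b.2])
      (fun i => [set b : Bm * Bp | D (net i) (b.1, b.2) <= C *+ 6])).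
have QX : {ae M, forall x, Q (y x).1 (y x).2}.
  apply: filterS3 net_cover (ae_foralln WmP) (ae_foralln WpP) => x [i Di] Hm Hp.
  rewrite /Q; case: (y x) Di Hm Hp => b1 b2 Di Hm Hp /=; split.
    by split; exists i; [exact: (Hm i).1|exact: (Hp i).1].
  by split=> j; [exact: (Hm j).2|exact: (Hp j).2].
(* The independence condition enters here through [y_null]: what holds for almost every value of [y]
   holds almost everywhere for the product measure. *)
have Qeta : {ae (num \x nup)%E, forall b, Q b.1 b.2}.
  apply/(negligibleP (num \x nup)%E); first exact: (measurableC mQ).
  apply: y_null; first exact: (measurableC mQ).
  apply/negligibleP => //; exact: (measurable_preimage y_meas (measurableC mQ)).
have [b2 Hb2] := ae_witness (ae_prodW_swap (Q := Q) Qeta).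
have [b1 [[_ [j Wj]] _]] := ae_witness Hb2.
exists (net j).
apply: filterS2 Qeta (ae_fst nup Hb2) => -[b1' b2'] /=
  [[[i Wi] _] [Hm _]] [_ [Hm' Hp']].
(* From [net j] to [net i] through [(b1', b2)] the cost is 6 + 7 + 1 = 14, and on to [(b1', b2')] it
   is 14 + 6 + 1 = 21. *)
have le1 := coarse_chain D_coarse (Hp' _ Wj) (coarse_flip D_coarse (Hm' _ Wi)).
apply: le_trans (coarse_chain D_coarse le1 (Hm _ Wi)) _.
by rewrite -!mulrSr -!mulrnDr -!mulrSr -!mulrnDr -!mulrSr.
Qed.

End two_boundaries.

(** * Invariance of the boundary maps and invariant sets *)

Section ergodic_components_facts.
Context d (G : borelGroupType d) (R : realType) dX (X : measurableType dX)
  (M : probability X R) (rho : X -> paths G nat) (law : set (paths G nat) ->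
    \bar R).
Context dB (B : measurableType dB) (nu : probability B R) (a : G -> B -> B)
  (bnd : paths G nat -> B).
Hypotheses (rho_meas : measurable_fun setT rho)
  (lawE : forall A, law A = M (rho @^-1` A))
  (comp : ergodic_components law (@shift1 _ G) (@path_action _ G nat) nu a bnd).

Lemma ae_law (Q : paths G nat -> Prop) :
  {ae law, forall xi, Q xi} -> {ae M, forall x, Q (rho x)}.
Proof. by apply: nonsingular_ae; split=> // A _; rewrite lawE. Qed.

Lemma law_aeW (Q : paths G nat -> Prop) :
  (forall xi, Q xi) -> {ae law, forall xi, Q xi}.
Proof.
move=> HQ; exists set0; split; first exact: measurable0.
  by rewrite lawE preimage_set0 measure0.
by move=> xi /= /(_ (HQ xi)).
Qed.

Lemma measurable_bnd : measurable_fun setT bnd.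
Proof. by have [_ []] := comp. Qed.

Lemma bnd_equivariant g :
  {ae M, forall x, bnd (path_action g (rho x)) = a g (bnd (rho x))}.
Proof. by have [_ [_ /(_ g)/ae_law]] := comp. Qed.

(** Ergodic components give invariance of bounded functions of [bnd]; applying it to the indicators
    of a separating sequence gives invariance of the point [bnd] itself. *)
Lemma bnd_shift1 : {ae M, forall x, bnd (shift1 (rho x)) = bnd (rho x)}.
Proof.
have [[/standard_borel_separating[A [mA sepA]] _] _ _ inv _] := comp.
have H : {ae M, forall x, forall n, A n (bnd (shift1 (rho x))) <->
  A n (bnd (rho x))}.
  apply: ae_foralln => n.
  have b1 : ess_bounded nu (\1_(A n) : B -> R).
    exists 1; apply: aeW => b; rewrite indicE.
    by case: (_ \in _); rewrite ?normr1// normr0.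
  have := inv _ (measurable_indic (mA n)) b1 => /ae_law; apply: filterS => x.
  rewrite !indicE; case: (boolP (bnd (shift1 _) \in _)) =>
    [/set_mem ? |/negP nA1];
    case: (boolP (bnd (rho x) \in _)) => [/set_mem ?|/negP nA2] //=.
  - by move/eqP; rewrite oner_eq0.
  - by move/esym/eqP; rewrite oner_eq0.
  - by move=> _; split=> /mem_set.
by apply: filterS H => x /sepA.
Qed.

Lemma bnd_invariant_set (V0 : set (paths G nat)) : measurable V0 ->
  (forall xi, V0 (shift1 xi) <-> V0 xi) ->
  exists2 W, measurable W & {ae M, forall x, V0 (rho x) <-> W (bnd (rho x))}.
Proof.
move=> mV V0s; have [_ _ _ _ fact] := comp.
have [|||h [mh _ hE]] := fact (\1_V0).
- exact: measurable_indic.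
- exists 1; apply: law_aeW => xi; rewrite indicE.
  by case: (_ \in _); rewrite ?normr1// normr0.
- apply: law_aeW => xi; rewrite !indicE; congr (_%:R).
  by congr nat_of_bool; apply/idP/idP => /set_mem Vxi; apply/mem_set/V0s.
(* The indicator of [V0] is almost everywhere [h] composed with [bnd], so a level set of [h]
   serves. *)
exists (h @^-1` [set 1]); first exact: (measurable_preimage mh (measurable_set1
  1)).
apply: filterS (ae_law hE) => x /= <-; rewrite indicE.
split=> [/mem_set -> //|/eqP]; case: (boolP (_ \in _)) => [/set_mem//|_].
by rewrite eq_sym oner_eq0.
Qed.

End ergodic_components_facts.

(** * The skew product of a cocycle *)

Section cocycle_facts.
Context d (G : borelGroupType d) dO (Omega : measurableType dO).
Variables (T Tinv : Omega -> Omega) (f : Omega -> G).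
Hypotheses (TK : cancel T Tinv) (TinvK : cancel Tinv T).

Local Notation X := (Omega * G)%type.
Local Notation phi := (cocycle T Tinv f).
Local Notation path := (path_of T Tinv f).

(** The group coordinate is updated so that the path of the image point is the shifted path, by the
    cocycle identity. *)
Definition skew_product (x : X) : X := (T x.1, (x.2 * (f x.1)^-1)%g).
Definition skew_product_inv (x : X) : X := (Tinv x.1, (x.2 * f (Tinv x.1))%g).

Lemma skew_productK : cancel skew_product skew_product_inv.
Proof. by move=> [w g]; rewrite /skew_product /skew_product_inv/=
  TK mulgVK. Qed.

Lemma skew_product_invK : cancel skew_product_inv skew_product.
Proof. by move=> [w g]; rewrite /skew_product /skew_product_inv/=
  TinvK mulgK. Qed.

Lemma cocycle_negE m w : phi (- m%:Z) w = cocycle_neg Tinv f m w.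
Proof. by case: m. Qed.

Lemma cocycleS i w : phi (i + 1) w = (phi i (T w) * f w)%g.
Proof.
case: i => m.
  rewrite (_ : Posz m + 1 = Posz m.+1); last by rewrite -PoszD addn1.
  elim: m => [|m IH] /=; first by rewrite mulg1 mul1g.
  by rewrite /= in IH *; rewrite IH mulgA -iterSr.
(* [Negz m] stands for [- (m + 1)], so the successor is [- m], including the case [m = 0], which
   [cocycle_negE] covers too. *)
rewrite (_ : Negz m + 1 = - m%:Z); last by rewrite NegzE -addn1 PoszD opprD
  addrNK.
rewrite cocycle_negE /=.
elim: m => [|m IH] /=; first by rewrite TK mulg1 mulVg.
rewrite /= in IH; rewrite IH mulgA; congr (_ * _)%g.
by rewrite -!iterS !iterSr TK.
Qed.

Lemma path_skew_product x i : path (skew_product x) i = path x (i + 1).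
Proof. by rewrite /path_of /skew_product/= cocycleS invgM invgK mulgA. Qed.

Lemma path_skew_product_inv x i : path (skew_product_inv x) i = path x (i - 1).
Proof. by rewrite -{2}(skew_product_invK x) path_skew_product subrK. Qed.

Lemma path_skew_product_iter n x i : path (iter n skew_product x) i =
  path x (i + n%:Z).
Proof.
elim: n i => [|n IH] i; first by rewrite addr0.
by rewrite iterS path_skew_product IH -addrA -PoszD add1n.
Qed.

Lemma path_skew_product_inv_iter n x i : path (iter n skew_product_inv x) i =
  path x (i - n%:Z).
Proof.
elim: n i => [|n IH] i; first by rewrite subr0.
by rewrite iterS path_skew_product_inv IH -addrA -opprD -PoszD add1n.
Qed.

(** Applied at an iterate of the skew product, this turns its group coordinate into a coordinate of
    the original path. *)
Lemma path0 x : (path x 0)^-1%g = x.2.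
Proof. by rewrite /path_of/= mul1g invgK. Qed.

Lemma path_start x i g : path (x.1, g) i = (path x i * x.2 * g^-1)%g.
Proof. by rewrite /path_of/= mulgVK. Qed.

Lemma skew_product_iter1 n x : (iter n skew_product x).1 = iter n T x.1.
Proof. by elim: n => //= n ->. Qed.

Lemma skew_product_inv_iter1 n x : (iter n skew_product_inv x).1 =
  iter n Tinv x.1.
Proof. by elim: n => //= n ->. Qed.

Lemma skew_product_iterE n x : iter n skew_product x = (iter n T x.1,
  (path x n%:Z)^-1%g).
Proof.
by rewrite [LHS]surjective_pairing skew_product_iter1 -[X in (_,
  X)]path0 path_skew_product_iter add0r.
Qed.

Lemma skew_product_inv_iterE n x : iter n skew_product_inv x =
  (iter n Tinv x.1, (path x (- n%:Z))^-1%g).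
Proof.
by rewrite [LHS]surjective_pairing skew_product_inv_iter1 -[X in (_,
  X)]path0 path_skew_product_inv_iter add0r.
Qed.

Lemma path_at_time n x i g : path (iter n T x.1, g) i =
  (path x (i + n%:Z) * (path x n%:Z)^-1 * g^-1)%g.
Proof. by rewrite -skew_product_iter1 path_start path_skew_product_iter
  skew_product_iterE. Qed.

Lemma path_at_past_time n x i g : path (iter n Tinv x.1, g) i =
  (path x (i - n%:Z) * (path x (- n%:Z))^-1 * g^-1)%g.
Proof. by rewrite -skew_product_inv_iter1 path_start path_skew_product_inv_iter
  skew_product_inv_iterE. Qed.

Lemma future_skew_product x : future (path (skew_product x)) =
  shift1 (future (path x)).
Proof.
by apply/funext => k; rewrite /future /shift1 path_skew_product -PoszD addn1.
Qed.

Lemma past_skew_product_inv x : past (path (skew_product_inv x)) =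
  shift1 (past (path x)).
Proof.
apply/funext => k; rewrite /past /shift1 path_skew_product_inv;
  congr (path x _).
by rewrite !NegzE -opprD -PoszD addn1.
Qed.

Lemma future_coordinates i : exists N, forall n, (N <= n)%N -> exists k,
  forall x g, path (iter n T x.1, g) i =
  (future (path x) k * (future (path x) n)^-1 * g^-1)%g.
Proof.
exists (absz i) => n iN; exists (absz (i + n%:Z)) => x g; rewrite path_at_time.
rewrite /future gez0_abs//; lia.
Qed.

Lemma past_coordinates i : exists N, forall n, (N <= n)%N -> exists k,
  forall x g, path (iter n Tinv x.1, g) i =
  (past (path x) k * (past (path x) n.-1)^-1 * g^-1)%g.
Proof.
(* The successor makes [i - n] strictly negative, and the predecessor is taken because index [k] of
   [past] is the coordinate [- (k + 1)]. *)
exists (absz i).+1 => n iN; exists (absz (i - n%:Z)).-1 => x g;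
  rewrite path_at_past_time.
rewrite /past !NegzE; congr (path x _ * (path x _)^-1 * _)%g; lia.
Qed.

Hypothesis G2 : @second_countable G.
Hypotheses (T_meas : measurable_fun setT T) (Tinv_meas :
  measurable_fun setT Tinv)
  (f_meas : measurable_fun setT f).

Lemma measurable_iter (S : Omega -> Omega) n :
  measurable_fun setT S -> measurable_fun setT (iter n S).
Proof.
move=> mS; elim: n => [|n IH]; first exact: measurable_id.
exact: (measurableT_comp mS IH).
Qed.

Lemma measurable_cocycle i : measurable_fun setT (phi i).
Proof.
case: i => m.
  elim: m => [|m IH] /=; first exact: measurable_cst.
  apply: measurable_fun_mulg => //.
  exact: (measurableT_comp f_meas (measurable_iter m T_meas)).
rewrite /cocycle; elim: m.+1 => [|n IH] /=; first exact: measurable_cst.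
apply: measurable_fun_mulg => //; apply: measurable_fun_invg.
exact: (measurableT_comp f_meas (measurable_iter n.+1 Tinv_meas)).
Qed.

Lemma measurable_path : measurable_fun setT path.
Proof.
apply: measurable_fun_paths => i; apply: measurable_fun_mulg => //.
  exact: (measurableT_comp (measurable_cocycle i) measurable_fst).
by apply: measurable_fun_invg; exact: measurable_snd.
Qed.

Lemma measurable_future : measurable_fun setT (@future _ G).
Proof. by apply: measurable_fun_paths => k; exact: measurable_coordinate. Qed.

Lemma measurable_past : measurable_fun setT (@past _ G).
Proof. by apply: measurable_fun_paths => k; exact: measurable_coordinate. Qed.

End cocycle_facts.

(** * Null sets of the law of the pair of boundary values *)

Section law_of_boundary_pair.
Context dX (X : measurableType dX) dP (Pt : measurableType dP) (R : realType)
  (M : probability X R) (path : X -> Pt).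
Context dB (B : measurableType dB) (nu : probability B R) (bnd : Pt -> B)
  dY (Y : measurableType dY) (eta : probability Y R) (pi : B -> Y) (y : X -> Y).
Hypotheses (path_meas : measurable_fun setT path)
  (bnd_meas : measurable_fun setT bnd) (pi_meas : measurable_fun setT pi)
  (nuE : forall A, measurable A -> nu A = M (path @^-1` (bnd @^-1` A)))
  (y_meas : measurable_fun setT y)
  (yE : {ae M, forall x, pi (bnd (path x)) = y x})
  (pi_eta : same_class (pushforward nu pi) eta).

Lemma pushforward_null A : measurable A ->
  pushforward nu pi A = 0%E <-> eta A = 0%E.
Proof.
move=> mA; have [dom1 dom2] := pi_eta; have mpA :=
  measurable_preimage pi_meas mA.
split=> A0.
  apply: (dom2 A) => // A' mA' A'A.
  apply: (subset_measure0 _ mpA) A0; first exact: (measurable_preimage pi_meas).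
  by move=> b; exact: A'A.
by apply: (dom1 A) => //; exact/measure0_null_setP.
Qed.

(** Off a null set [y] factors through [bnd] and [pi], so its law has the null sets of the image of
    [nu] under [pi], which are those of [eta]. *)
Lemma boundary_pair_null A : measurable A -> M (y @^-1` A) = 0%E <-> eta A =
  0%E.
Proof.
move=> mA; have mpA := measurable_preimage pi_meas mA.
have mbA := measurable_preimage path_meas (measurable_preimage bnd_meas mpA).
have myA := measurable_preimage y_meas mA.
rewrite -pushforward_null// /pushforward nuE//.
split=> /negligibleP A0; apply/negligibleP => //.
  apply: negligibleS (negligibleU (A0 myA) yE) => x Ax.
  have [e|ne] := pselect (pi (bnd (path x)) = y x); last by right.
  by left; rewrite /= -e.
apply: negligibleS (negligibleU (A0 mbA) yE) => x Ax.
have [e|ne] := pselect (pi (bnd (path x)) = y x); last by right.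
by left; rewrite /= e.
Qed.

End law_of_boundary_pair.

Theorem theorem1p6 (R : realType)
  (dG : measure_display) (G : borelGroupType dG)
  (G_hausdorff : hausdorff_space G)
  (G_locally_compact : locally_compact [set: G])
  (G_second_countable : @second_countable G)
  (muG : probability G R) (muG_haar : haar_class muG)
  (dO : measure_display) (Omega : measurableType dO)
  (P : probability Omega R) (Omega_standard : standard_borel R Omega)
  (T Tinv : Omega -> Omega)
  (TK : cancel T Tinv) (TinvK : cancel Tinv T)
  (T_measurable : measurable_fun setT T)
  (Tinv_measurable : measurable_fun setT Tinv)
  (T_preserving : measure_preserving P T) (T_ergodic : ergodic P T)
  (f : Omega -> G) (f_measurable : measurable_fun setT f)
  (dm : measure_display) (Bm : measurableType dm) (num : probability Bm R)
  (am : G -> Bm -> Bm) (bndm : paths G nat -> Bm)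
  (Bm_range : past_mackey_range P muG T Tinv f num am bndm)
  (dp : measure_display) (Bp : measurableType dp) (nup : probability Bp R)
  (ap : G -> Bp -> Bp) (bndp : paths G nat -> Bp)
  (Bp_range : future_mackey_range P muG T Tinv f nup ap bndp)
  (dB : measure_display) (B : measurableType dB) (nu : probability B R)
  (aB : G -> B -> B) (bnd : paths G int -> B)
  (B_range : mackey_range P muG T Tinv f nu aB bnd)
  (pim : B -> Bm)
  (pim_induced : induced_map P muG T Tinv f (@past _ G) nu aB bnd am bndm pim)
  (pip : B -> Bp)
  (pip_induced : induced_map P muG T Tinv f (@future _ G) nu aB bnd ap bndp pip)
  (independence : apafi nu num nup pim pip) :
  metrically_ergodic (num \x nup)%E (diag_action am ap) /\
  coarsely_metrically_ergodic (num \x nup)%E (diag_action am ap).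
Proof.
have mu_rmul := haar_class_rmul G_second_countable muG_haar.
pose M := (P \x muG)%E : probability (Omega * G)%type R.
pose path := path_of T Tinv f.
have mpath : measurable_fun setT path by exact: measurable_path.
have mpast : measurable_fun setT (fun x => past (path x)).
  exact: (measurableT_comp (@measurable_past _ G) mpath).
have mfuture : measurable_fun setT (fun x => future (path x)).
  exact: (measurableT_comp (@measurable_future _ G) mpath).
have past_lawE A : past_law P muG T Tinv f A = M ((fun x => past (path x))
  @^-1` A) by [].
have future_lawE A : future_law P muG T Tinv f A = M ((fun x =>
  future (path x)) @^-1` A) by [].
pose yy (xi : paths G int) := (bndm (past xi), bndp (future xi)).
have myy : measurable_fun setT yy.
  apply/measurable_fun_pairP; split.
    exact: (measurableT_comp (measurable_bnd Bm_range) (@measurable_past _ G)).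
  exact: (measurableT_comp (measurable_bnd Bp_range) (@measurable_future _ G)).
have my : measurable_fun setT (fun x => yy (path x)) by exact:
  (measurableT_comp myy mpath).
have [nsm nsp] : nonsingular_action num am /\ nonsingular_action nup ap.
  by have [[_ ?] _ _ _ _] := Bm_range; have [[_ ?] _ _ _ _] := Bp_range.
have [[am1 amM] mam _] := nsm; have [[ap1 apM] map _] := nsp.
pose aY := diag_action am ap; pose eta := (num \x nup)%E :
  probability (Bm * Bp)%type R.
have aY_act : is_action aY.
  split=> [[b1 b2]|g h [b1 b2]]; rewrite /aY /diag_action/=.
    by rewrite am1 ap1.
  by rewrite amM apM.
have maY : measurable_fun [set: G * (Bm * Bp)] (fun p => aY p.1 p.2).
  have m1 : measurable_fun setT (fun p : G * (Bm * Bp) => (p.1, p.2.1)).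
    apply/measurable_fun_pairP; split; first exact: measurable_fst.
    exact: (measurableT_comp measurable_fst measurable_snd).
  have m2 : measurable_fun setT (fun p : G * (Bm * Bp) => (p.1, p.2.2)).
    apply/measurable_fun_pairP; split; first exact: measurable_fst.
    exact: (measurableT_comp measurable_snd measurable_snd).
  apply/measurable_fun_pairP; split.
    exact: (measurableT_comp mam m1).
  exact: (measurableT_comp map m2).
have aY_ns g : nonsingular eta eta (aY g).
  apply: (nonsingular_prod (m := num) (n := nup) (s := am g) (t := fun=> ap g)).
  - exact: nonsingular_actionW nsm g.
  - exact: (measurableT_comp (nonsingular_actionW nsp g).1 measurable_snd).
  - by move=> _; exact: nonsingular_actionW nsp g.
have y_null A : measurable A -> M ((fun x => yy (path x)) @^-1` A) = 0%E <->
  eta A = 0%E.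
  have [mpim _ pimE] := pim_induced; have [mpip _ pipE] := pip_induced.
  have [_ [mbnd _] nuE _ _] := B_range.
  apply: (@boundary_pair_null _ _ _ _ R M path _ _ nu bnd _ _ eta (fun b =>
    (pim b, pip b))) => //.
  - exact/measurable_fun_pairP.
  - have toM Q : {ae path_law P muG T Tinv f, forall x, Q x} -> {ae M,
    forall x, Q (path x)}.
      by apply: nonsingular_ae; split.
    by apply: filterS2 (toM _ pimE) (toM _ pipE) => x /= -> ->.
have path_actionE (h : G) (x : Omega * G) :
    path (x.1, (h * x.2)%g) = path_action h (path x).
  by apply/funext => i; rewrite /path /path_of /path_action/= invgM mulgA.
have y_equiv h : {ae M, forall x, yy (path (x.1, (h * x.2)%g)) =
  aY h (yy (path x))}.
  have Em := bnd_equivariant mpast past_lawE Bm_range h.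
  have Ep := bnd_equivariant mfuture future_lawE Bp_range h.
  apply: filterS2 Em Ep => x e1 e2.
  by rewrite path_actionE /aY /diag_action/= -e1 -e2.
have skew_ns : nonsingular M M (skew_product T f).
  apply: (nonsingular_prod (m := P) (n := muG) (s := T) (t := fun w g =>
    (g * (f w)^-1)%g)) => //.
  - by split=> // A mA A0; have := T_preserving _ mA; rewrite /pushforward =>
    ->.
  - apply: measurable_fun_mulg => //; apply: measurable_fun_invg.
    exact: (measurableT_comp f_measurable measurable_fst).
have Tinv_preserving : measure_preserving P Tinv.
  move=> A mA; have mA' := measurable_preimage Tinv_measurable mA.
  rewrite /pushforward -(T_preserving _ mA') /pushforward; congr (P _).
  by apply/seteqP; split=> w; rewrite /= TK.
have skew_inv_ns : nonsingular M M (skew_product_inv Tinv f).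
  apply: (nonsingular_prod (m := P) (n := muG) (s := Tinv) (t := fun w g =>
    (g * f (Tinv w))%g)) => //.
  - by split=> // A mA A0; have := Tinv_preserving _ mA;
    rewrite /pushforward => ->.
  - apply: measurable_fun_mulg => //.
    exact: (measurableT_comp (measurableT_comp f_measurable Tinv_measurable)
      measurable_fst).
have ym_inv : {ae M, forall x, bndm (past (path (skew_product_inv Tinv f x)))
  = bndm (past (path x))}.
  apply: filterS (bnd_shift1 mpast past_lawE Bm_range) => x <-.
  by rewrite past_skew_product_inv.
have yp_skew : {ae M, forall x, bndp (future (path (skew_product T f x))) =
  bndp (future (path x))}.
  apply: filterS (bnd_shift1 mfuture future_lawE Bp_range) => x <-.
  by rewrite future_skew_product.
have y_skew : {ae M, forall x, yy (path (skew_product T f x)) = yy (path x)}.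
  (* The past boundary value is invariant under the inverse skew product; evaluating this at the
     image of a point gives invariance under the skew product itself. *)
  have ym := nonsingular_ae skew_ns ym_inv.
  apply: filterS2 ym yp_skew => x.
  by rewrite skew_productK // /yy => -> ->.
have y_skew_inv : {ae M, forall x, yy (path (skew_product_inv Tinv f x)) =
  yy (path x)}.
  apply: filterS2 ym_inv (nonsingular_ae skew_inv_ns yp_skew) => x.
  by rewrite skew_product_invK // /yy => -> ->.
have rigid : coarsely_rigid eta aY.
  move=> C D D_coarse mD D_inv D_pos.
  have mDle : measurable [set p : (Bm * Bp) * (Bm * Bp) | D p.1 p.2 <= C].
    exact: measurable_set_le.
  (* The net is chosen among these points, which form a conull set by Fubini, so that it satisfies
     the hypothesis [net_inv]. *)
  pose generic b := {ae muG, forall k, {ae eta, forall b', D (aY k b)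
    (aY k b') = D b b'}}.
  have generic_ae : {ae eta, forall b, generic b}.
    apply: (ae_swap (m := muG) (n := eta) (Q := fun k b =>
      {ae eta, forall b', D (aY k b) (aY k b') = D b b'})); last first.
      apply: aeW => k.
      exact: (ae_prodW (Q := fun b b' => D (aY k b) (aY k b') = D b b')
        (D_inv k)).
    apply: (measurable_ae_section eta (Q := fun (p : G * (Bm * Bp)) b' =>
      D (aY p.1 p.2) (aY p.1 b') = D p.2 b')).
    have m1 : measurable_fun setT (fun q : (G * (Bm * Bp)) * (Bm * Bp) =>
      q.1.1).
      exact: (measurableT_comp measurable_fst measurable_fst).
    have m2 : measurable_fun setT (fun q : (G * (Bm * Bp)) * (Bm * Bp) =>
      q.1.2).
      exact: (measurableT_comp measurable_snd measurable_fst).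
    have m3 : measurable_fun setT (fun q : (G * (Bm * Bp)) * (Bm * Bp) => q.2)
      := measurable_snd.
    by apply: measurable_set_eq; apply: measurable_fun_D => //; apply:
      measurable_fun_aY.
  have [net [net_generic net_cover]] :=
    countable_net (E := fun b b' => D b b' <= C) mDle generic_ae D_pos.
  have y_ns : nonsingular M eta (fun x => yy (path x)).
    by split=> // A mA /(y_null _ mA).
  have coverM : {ae M, forall x, exists i, D (net i) (yy (path x)) <= C}.
    exact: (nonsingular_ae y_ns net_cover).
  have netM i : {ae muG, forall k, {ae M, forall x,
      D (aY k (net i)) (aY k (yy (path x))) = D (net i) (yy (path x))}}.
    by apply: filterS (net_generic i) => k; exact: (nonsingular_ae y_ns).
  apply: (product_bound (M := M) (y := fun x => yy (path x)) (net := net)) =>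
    //.
  - by move=> A mA /(y_null _ mA).
  (* The past: time runs backwards along the inverse skew product. *)
  - have mc : measurable_fun setT (fun w => f (Tinv w)).
      exact: (measurableT_comp f_measurable Tinv_measurable).
    have iterE n x : (0 < n)%N -> iter n (skew_product_inv Tinv f) x =
        (iter n Tinv x.1, (past (path x) n.-1)^-1%g).
      by case: n => // n _; exact: skew_product_inv_iterE.
    exact: (boundary_level G_second_countable mu_rmul mpath myy aY_act maY
      y_equiv
      D_coarse mD coverM netM mpast Tinv_measurable Tinv_preserving mc
        y_skew_inv
      (past_skew_product_inv f TK TinvK) iterE (past_coordinates f TK TinvK)
      (bnd_invariant_set mpast past_lawE Bm_range)).
  (* The future: time runs forwards along the skew product. *)
  - have mc : measurable_fun setT (fun w => (f w)^-1%g) by exact: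
    measurable_fun_invg.
    have iterE n x : (0 < n)%N -> iter n (skew_product T f) x =
        (iter n T x.1, (future (path x) n)^-1%g).
      by move=> _; exact: skew_product_iterE.
    exact: (boundary_level G_second_countable mu_rmul mpath myy aY_act maY
      y_equiv
      D_coarse mD coverM netM mfuture T_measurable T_preserving mc y_skew
      (future_skew_product f TK) iterE (future_coordinates f TK)
      (bnd_invariant_set mfuture future_lawE Bp_range)).
split; first exact: rigid_metrically_ergodic.
exact: rigid_coarsely_metrically_ergodic.
Qed.
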